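(* Let $\Delta\ge 1$ be an integer and let $G=(V,E)$ be an unweighted, possibly directed graph with $|V|=n$ and $|E|=m$, whose edges are colored (arbitrarily) so that every color class has at most $\Delta$ edges. Let $S\subseteq V$ be a set of sources. Then there is a $1$-CFT $S\times V$ distance preserver $H\subseteq G$ with \[ |E(H)| = O\Big( n^{2-\frac{1}{\Delta+1}} \cdot |S|^{\frac{1}{\Delta+1}} \cdot \Delta\, (\log n)^{1-\frac{1}{\Delta+1}}\Big), \] and such an $H$ can be computed in $O(|S|\, m\, n)$ time.
   Context: An edge-colored graph assigns each edge exactly one color, with no restrictions (adjacent edges may share a color); a color class is the set of edges of one color. For a set $F$ of colors, $G-F$ denotes $G$ with all edges whose color is in $F$ deleted; $G-c$ means $G-\{c\}$. For a set $P$ of vertex pairs, a subgraph $H\subseteq G$ is an $f$-CFT ($f$-color fault-tolerant) $P$-distance preserver if for every set $F$ of at most $f$ colors and every $(s,t)\in P$, the distance from $s$ to $t$ in $H-F$ equals the distance from $s$ to $t$ in $G-F$ (distance $\infty$ if unreachable). *)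

(* Defs.v *)
From HB Require Import structures.
From mathcomp Require Import all_boot all_order all_algebra.
From mathcomp Require Import finmap.
From mathcomp Require Import boolp reals exp.

Set Implicit Arguments.
Unset Strict Implicit.
Unset Printing Implicit Defensive.

Import Order.TTheory GRing.Theory Num.Theory.

(* A simple graph on 'I_n, directed or undirected.  An undirected edge {u, v}
   is stored once, as the ordered pair (u, v) with u < v, so that #|edges G|
   counts unordered pairs in the undirected case.  Values of [color] outside
   [edges] are irrelevant. *)
Record cgraph (n : nat) := CGraph {
  directed : bool;
  edges : {set 'I_n * 'I_n};
  color : 'I_n * 'I_n -> nat;
  edges_wf : forall e, e \in edges -> if directed then e.1 != e.2 else e.1 < e.2
}.

Definition color_class n (G : cgraph n) (c : nat) : {set 'I_n * 'I_n} :=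
  [set e in edges G | color G e == c].

(* A subgraph of G (on the same vertices) is given by its edge set X. *)
Definition remove_colors n (G : cgraph n) (X : {set 'I_n * 'I_n})
    (F : {fset nat}) : {set 'I_n * 'I_n} :=
  [set e in X | color G e \notin F].

Definition adj n (G : cgraph n) (X : {set 'I_n * 'I_n}) : rel 'I_n :=
  fun x y => ((x, y) \in X) || (~~ directed G && ((y, x) \in X)).

Definition has_walk (V : finType) (r : rel V) (s t : V) : pred nat :=
  fun k => [exists p : k.-tuple V, path r s p && (last s p == t)].

(* None stands for the distance oo. *)
Definition dist (V : finType) (r : rel V) (s t : V) : option nat :=
  if pselect (exists k, has_walk r s t k) is left h then Some (ex_minn h)
  else None.

Definition cft_preserver n (f : nat) (G : cgraph n) (P : {set 'I_n * 'I_n})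
    (H : {set 'I_n * 'I_n}) : Prop :=
  H \subset edges G /\
  forall F : {fset nat}, #|` F| <= f ->
  forall s t : 'I_n, (s, t) \in P ->
    dist (adj G (remove_colors G H F)) s t =
    dist (adj G (remove_colors G (edges G) F)) s t.

(* A unit-cost word RAM: structured programs over registers and arrays of words; words are naturals
   below W.  Register and array names are literals, so a program uses a fixed
   number of them; only array indices are computed.  Each register access,
   array access, arithmetic operation, test and assignment costs 1. *)
Inductive expr :=
| Num of nat
| Reg of nat
| Get of nat & expr
| Add of expr & expr
| Sub of expr & expr
| Eq of expr & expr
| Lt of expr & expr.

Inductive cmd :=
| Skip
| SetReg of nat & expr
| SetArr of nat & expr & expr
| Seq of cmd & cmd
| If of expr & cmd & cmd
| While of expr & cmd.

Record state := State { reg : nat -> nat; arr : nat -> nat -> nat }.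

(* Addition wraps around at W; subtraction is truncated at 0. *)
Fixpoint eval (W : nat) (st : state) (e : expr) : nat :=
  match e with
  | Num k => k %% W
  | Reg i => reg st i
  | Get a e1 => arr st a (eval W st e1)
  | Add e1 e2 => (eval W st e1 + eval W st e2) %% W
  | Sub e1 e2 => eval W st e1 - eval W st e2
  | Eq e1 e2 => (eval W st e1 == eval W st e2) %% W
  | Lt e1 e2 => (eval W st e1 < eval W st e2) %% W
  end.

Fixpoint ecost (e : expr) : nat :=
  match e with
  | Num _ | Reg _ => 1
  | Get _ e1 => (ecost e1).+1
  | Add e1 e2 | Sub e1 e2 | Eq e1 e2 | Lt e1 e2 => (ecost e1 + ecost e2).+1
  end.

Definition set_reg (st : state) (i v : nat) : state :=
  State (fun j => if j == i then v else reg st j) (arr st).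

Definition set_arr (st : state) (a i v : nat) : state :=
  State (reg st)
    (fun b j => if (b == a) && (j == i) then v else arr st b j).

(* exec W p st t st' : on words below W, program p started in st halts in st'
   after t time units. *)
Inductive exec (W : nat) : cmd -> state -> nat -> state -> Prop :=
| ExecSkip st : exec W Skip st 1 st
| ExecSetReg st i e :
    exec W (SetReg i e) st (ecost e).+1 (set_reg st i (eval W st e))
| ExecSetArr st a e1 e2 :
    exec W (SetArr a e1 e2) st (ecost e1 + ecost e2).+1
      (set_arr st a (eval W st e1) (eval W st e2))
| ExecSeq p1 p2 st st1 st2 t1 t2 :
    exec W p1 st t1 st1 -> exec W p2 st1 t2 st2 ->
    exec W (Seq p1 p2) st (t1 + t2) st2
| ExecIfTrue e p1 p2 st st' t :
    eval W st e != 0 -> exec W p1 st t st' ->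
    exec W (If e p1 p2) st (ecost e + t).+1 st'
| ExecIfFalse e p1 p2 st st' t :
    eval W st e = 0 -> exec W p2 st t st' ->
    exec W (If e p1 p2) st (ecost e + t).+1 st'
| ExecWhileTrue e p st st1 st2 t1 t2 :
    eval W st e != 0 -> exec W p st t1 st1 -> exec W (While e p) st1 t2 st2 ->
    exec W (While e p) st (ecost e + t1 + t2).+1 st2
| ExecWhileFalse e p st :
    eval W st e = 0 -> exec W (While e p) st (ecost e).+1 st.

(* The input: registers 0-3 hold n, m, |S| and the directedness flag; arrays
   0-2 hold the two endpoints and the color of the i-th listed edge, array 3
   the listed sources; everything else is 0. *)
Definition init_state n (G : cgraph n) (es : seq ('I_n * 'I_n))
    (ss : seq 'I_n) : state :=
  State
    (fun i => nth 0 [:: n; size es; size ss; nat_of_bool (directed G)] i)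
    (fun a i => nth 0 (nth [::]
       [:: [seq val e.1 | e <- es];
           [seq val e.2 | e <- es];
           [seq color G e | e <- es];
           [seq val s | s <- ss]] a) i).

(* The output: array 4 marks the positions of the selected edges. *)
Definition output n (es : seq ('I_n * 'I_n)) (st : state) :
    {set 'I_n * 'I_n} :=
  [set e in es | arr st 4 (index e es) != 0].

Local Open Scope ring_scope.

Definition size_bound (R : realType) (Delta n s : nat) : R :=
  let a : R := Delta.+1%:R^-1 in
  n%:R `^ (2 - a) * s%:R `^ a * Delta%:R * ln n%:R `^ (1 - a).

(* Main.v *)
Require Import Defs.
From HB Require Import structures.
From mathcomp Require Import all_boot all_order all_algebra.
From mathcomp Require Import finmap.
From mathcomp Require Import boolp reals exp.
From mathcomp Require Import zify ring lra.

Set Implicit Arguments.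
Unset Strict Implicit.
Unset Printing Implicit Defensive.

Import Order.TTheory GRing.Theory Num.Theory.

(** Why few edges suffice.  Write E_c(x, t) for the first arc (u, t), in a fixed
    order of the arcs, that ends a shortest path from x to t once the color c has
    failed, and E(x, t) for the choice without failure.  The preserver consists of all arcs E_c(s, t) with s in S.  An arc that
    ends a shortest path from x through y is also the first choice for y, so
    E_c(y, t) = E_c(x, t) for such y.
    Fix t and a threshold q.  Starting from R_0 = S, let R_(j+1) hit, for every
    arc e = E_c(s, t), the set of vertices y at distance at most q^(Delta - j)
    from t with E_c(y, t) = e; a greedy hitting set has about
    n log n / q^(Delta - j) elements.  For x in R_j let Q(x) be a shortest path
    from x to t ending in E(x, t).  If Q(x) avoids c, then E_c(x, t) = E(x, t); if
    c occurs on one of the last q^(Delta - j) arcs of Q(x), there are few choices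
    for c.  Otherwise c occurs on Q(x) farther from t than the next hitting vertex
    is, so passing from j to j + 1 produces a new arc of color c, strictly closer
    to t.  This can happen at most Delta times, hence t has at most
    sum_j |R_j| (1 + q^(Delta - j)) incoming arcs; q balances the summands.

    Why they are found quickly.  If c is not the color of any E(s, v), its failure
    does not change the arcs chosen for s.  So for each s one breadth-first search
    without failures and one for each of the at most min(n - 1, 2m) tree arcs
    suffice. *)

(** * Distances and last arcs *)

Section Walks.
Variables (V : finType) (r : rel V).

Lemma has_walkP s t k :
  reflect (exists p, [/\ size p = k, path r s p & last s p = t])
    (has_walk r s t k).
Proof.
apply: (iffP existsP) => [[p /andP[h1 /eqP h2]]|[p [h1 h2 h3]]].
  by exists p; rewrite size_tuple.
by move/eqP: h1 => h1; exists (Tuple h1) => /=; rewrite h2 h3 eqxx.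
Qed.

Lemma has_walk0 s t : has_walk r s t 0 = (s == t).
Proof.
apply/has_walkP/eqP => [[p [/size0nil-> _ <-]] //|->].
by exists [::].
Qed.

Lemma has_walk1 s t : has_walk r s t 1 = r s t.
Proof.
apply/has_walkP/idP => [[[|x [|y p]] [//= _ h h']]|h].
  by move: h h' => /= /andP[h _] <-.
by exists [:: t]; rewrite /= h.
Qed.

Lemma has_walk_cat x y z i j :
  has_walk r x y i -> has_walk r y z j -> has_walk r x z (i + j).
Proof.
move=> /has_walkP[p [<- h1 <-]] /has_walkP[q [<- h2 <-]].
by apply/has_walkP; exists (p ++ q); rewrite size_cat cat_path last_cat h1 h2.
Qed.

Lemma has_walk_split x z i j :
  has_walk r x z (i + j) ->
  exists2 y, has_walk r x y i & has_walk r y z j.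
Proof.
move=> /has_walkP[p [hs hp <-]]; rewrite -(cat_take_drop i p) in hp *.
move: hp; rewrite cat_path => /andP[h1 h2].
exists (last x (take i p)); apply/has_walkP.
  by exists (take i p); rewrite size_takel // hs leq_addr.
by exists (drop i p); rewrite size_drop hs addKn last_cat.
Qed.

Lemma distP s t k :
  dist r s t = Some k <->
  has_walk r s t k /\ forall j, has_walk r s t j -> k <= j.
Proof.
rewrite /dist; case: pselect => [h|h]; last first.
  by split=> // -[hk _]; case: h; exists k.
case: ex_minnP => m hm hmin; split=> [[<-] //|[h1 h2]].
by congr Some; apply/eqP; rewrite eqn_leq hmin // h2.
Qed.

Lemma dist_ex s t k : has_walk r s t k -> exists2 j, j <= k & dist r s t = Some j.
Proof.
rewrite /dist => hk; case: pselect => [h|h]; last by case: h; exists k.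
by case: ex_minnP => m hm /(_ _ hk) ?; exists m.
Qed.

Lemma dist_walk s t k : dist r s t = Some k -> has_walk r s t k.
Proof. by case/distP. Qed.

Lemma dist_min s t k j : dist r s t = Some k -> has_walk r s t j -> k <= j.
Proof. by case/distP => _; apply. Qed.

Lemma dist0 s : dist r s s = Some 0.
Proof. by apply/distP; rewrite has_walk0. Qed.

Lemma dist_eq0 s t : dist r s t = Some 0 -> s = t.
Proof. by move/dist_walk; rewrite has_walk0 => /eqP. Qed.

Lemma dist_split x z i j :
  dist r x z = Some (i + j) ->
  exists2 y, dist r x y = Some i & dist r y z = Some j.
Proof.
move=> h; have /has_walk_split[y h1 h2] := dist_walk h; exists y; apply/distP.
  split=> // k hk; have := dist_min h (has_walk_cat hk h2); lia.
split=> // k hk; have := dist_min h (has_walk_cat h1 hk); lia.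
Qed.

Lemma dist_step x y k : dist r x y = Some k.+1 ->
  exists2 z, dist r x z = Some k & r z y.
Proof.
rewrite -addn1 => /dist_split[z h1 h2]; exists z => //.
by rewrite -has_walk1 dist_walk.
Qed.

Lemma dist_edge x y z k l : dist r x y = Some k -> r y z -> dist r x z = Some l -> l <= k.+1.
Proof.
by rewrite -has_walk1 -(addn1 k) => /dist_walk h1 h2 /dist_min; apply; apply: has_walk_cat h2.
Qed.

End Walks.

Lemma has_walk_sub (V : finType) (r r' : rel V) s t k :
  subrel r r' -> has_walk r s t k -> has_walk r' s t k.
Proof.
move=> h /has_walkP[p [h1 h2 h3]]; apply/has_walkP; exists p; split=> //.
exact: sub_path h2.
Qed.

Lemma eq_dist (V : finType) (r r' : rel V) : r =2 r' -> dist r =2 dist r'.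
Proof.
by move=> h s t; congr dist; apply/funext => x; apply/funext => y.
Qed.

(** * First choices among the arcs that end shortest paths *)

Section FirstArc.
(* [o] is the failed color, if any; [arcs] fixes the tie-breaking order. *)
Variables (V : finType) (arcs : seq (V * V)) (col : V * V -> nat).

Definition alive (o : option nat) (a : V * V) := o != Some (col a).

Definition avoid (o : option nat) : rel V :=
  fun x y => ((x, y) \in arcs) && alive o (x, y).

Lemma avoidE o x y : avoid o x y = ((x, y) \in arcs) && alive o (x, y).
Proof. by []. Qed.

(** These arcs form the shortest-path DAG from [x] after the failure; membership in [arcs] is left
    to the filter in [last_arc]. *)
Definition tight (o : option nat) (x : V) (a : V * V) : bool :=
  alive o a &&
  (if dist (avoid o) x a.1 is Some k then dist (avoid o) x a.2 == Some k.+1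
   else false).

Definition last_arc (o : option nat) (x t : V) : option (V * V) :=
  ohead [seq a <- arcs | (a.2 == t) && tight o x a].

Lemma last_arcP o x t a : last_arc o x t = Some a ->
  [/\ a \in arcs, a.2 = t, alive o a &
    exists2 k, dist (avoid o) x a.1 = Some k & dist (avoid o) x t = Some k.+1].
Proof.
rewrite /last_arc; case E: [seq _ <- _ | _] => [|b l] //= [Eb]; subst b.
have : a \in [seq a <- arcs | (a.2 == t) && tight o x a] by rewrite E mem_head.
rewrite mem_filter => /andP[/andP[/eqP<- /andP[h1 h2]] h3]; split=> //.
by move: h2; case: dist => // k /eqP ->; exists k.
Qed.

Lemma last_arc_ex o x t k : dist (avoid o) x t = Some k.+1 ->
  exists a, last_arc o x t = Some a.
Proof.
move=> h; have [z hz /andP[h1 h2]] := dist_step h.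
rewrite /last_arc; case E: [seq _ <- _ | _] => [|b l] /=; last by exists b.
have : (z, t) \in [seq a <- arcs | (a.2 == t) && tight o x a].
  by rewrite mem_filter /= eqxx h1 /tight h2 hz h eqxx.
by rewrite E.
Qed.

Lemma last_arc_src o x : last_arc o x x = None.
Proof.
by case E: last_arc => [a|] //; have [_ _ _ [k _]] := last_arcP E; rewrite dist0.
Qed.

Lemma ohead_filter_sub (T : eqType) (p p' : pred T) (s : seq T) a :
  {in s, subpred p' p} -> ohead (filter p s) = Some a -> p' a ->
  ohead (filter p' s) = Some a.
Proof.
elim: s => [|b s IH] //= h.
case: (boolP (p b)) => hp /=; first by case=> E; rewrite E => ->.
move=> h1 h2.
have -> : p' b = false by apply: contraNF hp; apply: h; rewrite mem_head.
by apply: IH => // c hc; apply: h; rewrite in_cons hc orbT.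
Qed.

(** Consistency of the tie-breaking: whatever precedes the first of many candidates is not a
    candidate after the set has shrunk, so the first one stays first if it survives. *)
Lemma last_arc_sub o x o' x' t a :
  (forall b, b \in arcs -> b.2 = t -> tight o' x' b -> tight o x b) ->
  last_arc o x t = Some a -> tight o' x' a -> last_arc o' x' t = Some a.
Proof.
move=> h h1 h2; have [_ ht _ _] := last_arcP h1.
apply: ohead_filter_sub h1 _; last by rewrite ht eqxx.
by move=> b hb /andP[/eqP h3 h4]; rewrite h3 eqxx h.
Qed.

Lemma tightP o x a : reflect
  (alive o a /\ exists2 k, dist (avoid o) x a.1 = Some k & dist (avoid o) x a.2 = Some k.+1)
  (tight o x a).
Proof.
apply: (iffP andP) => [[h1 h2]|[h1 [k h2 h3]]]; split=> //.
  by move: h2; case: dist => // k /eqP ?; exists k.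
by rewrite h2 h3.
Qed.

(* If the arc [a] ends a shortest path from [x] through [y], every arc that is
   tight for [y] is tight for [x]. *)
Lemma last_arc_suffix o x y t a i j :
  last_arc o x t = Some a ->
  dist (avoid o) x y = Some i -> dist (avoid o) y a.1 = Some j ->
  dist (avoid o) x a.1 = Some (i + j) ->
  last_arc o y t = Some a /\ dist (avoid o) y t = Some j.+1.
Proof.
move=> h hxy hya hxa; have [ha ht hal [k]] := last_arcP h.
rewrite hxa => -[<-] hxt {k}.
have hrel : avoid o a.1 t by rewrite /avoid -ht -surjective_pairing ha.
have hwt : has_walk (avoid o) y t j.+1.
  by rewrite -addn1; apply: has_walk_cat (dist_walk hya) _; rewrite has_walk1.
have hyt : dist (avoid o) y t = Some j.+1.
  apply/distP; split=> // l hl.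
  have := dist_min hxt (has_walk_cat (dist_walk hxy) hl); lia.
split=> //; apply: last_arc_sub h _; last first.
  by apply/tightP; split=> //; exists j; rewrite // ht.
move=> b hb hbt /tightP[hbo [l h1 h2]].
move: h2; rewrite hbt hyt => -[E]; subst l.
apply/tightP; split=> //; exists (i + j); last by rewrite hbt hxt.
have [l hl hd] := dist_ex (has_walk_cat (dist_walk hxy) (dist_walk h1)).
have hrb : avoid o b.1 t by rewrite /avoid -hbt -surjective_pairing hb.
have := dist_edge hd hrb hxt => h3; rewrite hd; congr Some; lia.
Qed.

(** Cut a shortest path through [a] at distance [k] from [t]; the suffix inherits [a]. Hence every
    level up to [d] has a vertex choosing [a], which makes the sets to be hit large. *)
Lemma last_arc_level o x t a d k :
  last_arc o x t = Some a -> dist (avoid o) x t = Some d -> 0 < k <= d ->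
  exists2 y, dist (avoid o) y t = Some k & last_arc o y t = Some a.
Proof.
move=> h hd /andP[h0 hk]; have [_ _ _ [e he]] := last_arcP h.
rewrite hd => -[E]; subst d.
have E : e = (e.+1 - k) + k.-1 by lia.
rewrite E in he; have [y h1 h2] := dist_split he.
have [h3 h4] := last_arc_suffix h h1 h2 he; exists y => //.
by rewrite h4; congr Some; lia.
Qed.

Lemma sub_avoid c : subrel (avoid (Some c)) (avoid None).
Proof. by move=> x y /andP[h _]; rewrite /avoid h. Qed.

Lemma dist_avoid c x t k : dist (avoid (Some c)) x t = Some k ->
  exists2 j, j <= k & dist (avoid None) x t = Some j.
Proof. by move/dist_walk/(has_walk_sub (@sub_avoid c))/dist_ex. Qed.

(** If a shortest path through [a] survives, the distances to [a.1] and [t] do not change, so an arc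
    into [t] that is tight after the failure was tight before; [last_arc_sub] then applies. *)
Lemma last_arc_avoid c x t a k :
  last_arc None x t = Some a -> alive (Some c) a ->
  dist (avoid None) x t = Some k.+1 ->
  has_walk (avoid (Some c)) x a.1 k -> last_arc (Some c) x t = Some a.
Proof.
move=> h hc hd hw; have [ha ht _ [k']] := last_arcP h.
rewrite hd => hk [E]; subst k'.
have hwt : has_walk (avoid (Some c)) x t k.+1.
  rewrite -addn1; apply: has_walk_cat hw _.
  by rewrite has_walk1 /avoid -ht -surjective_pairing ha.
have hD y l : dist (avoid None) x y = Some l -> has_walk (avoid (Some c)) x y l ->
    dist (avoid (Some c)) x y = Some l.
  move=> h1 h2; apply/distP; split=> // j hj; apply: dist_min h1 _.
  exact: has_walk_sub (@sub_avoid c) hj.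
have hdt := hD _ _ hd hwt.
apply: last_arc_sub h _; last first.
  by apply/tightP; split=> //; exists k; rewrite ?ht //; apply: hD.
move=> b hb hbt /tightP[hbo [l h1]]; rewrite hbt hdt => -[E]; subst l.
apply/tightP; split=> //; exists k; last by rewrite hbt.
have [j hj h2] := dist_avoid h1.
have hrb : avoid None b.1 t by rewrite /avoid -hbt -surjective_pairing hb.
by have h3 := dist_edge h2 hrb hd; rewrite h2; congr Some; lia.
Qed.

(* The arcs of a shortest path ending in [last_arc None x t], indexed from
   the end. *)
Lemma spine_ex x t : exists f : nat -> V * V, forall d, dist (avoid None) x t = Some d ->
  (forall k, k < d -> [/\ f k \in arcs, dist (avoid None) (f k).2 t = Some k
    & dist (avoid None) (f k).1 t = Some k.+1]) /\
  (forall c, (forall k, k < d -> col (f k) != c) ->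
     last_arc (Some c) x t = last_arc None x t).
Proof.
case E: (dist (avoid None) x t) => [d|]; last by exists (fun=> (t, t)).
case: d E => [|d] E.
  have <- := dist_eq0 E; exists (fun=> (t, t)) => _ [<-].
  by split=> // c _; rewrite !last_arc_src.
have [a ha] := last_arc_ex E.
have [h1 h2 _ [k h3]] := last_arcP ha; rewrite E => -[E']; subst k.
(* Induction on the length of the prefix from [x]. As arcs are numbered from [t], a prefix of length
   [e] carries the last [e] indices below [d.+1]. *)
have sub2 y e : dist (avoid None) x y = Some e -> has_walk (avoid None) y t (d.+1 - e) -> e <= d.+1 ->
  exists f : nat -> V * V,
  (forall k, d.+1 - e <= k < d.+1 -> [/\ f k \in arcs, dist (avoid None) (f k).2 t = Some k
    & dist (avoid None) (f k).1 t = Some k.+1]) /\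
  (forall c, (forall k, d.+1 - e <= k < d.+1 -> col (f k) != c) -> has_walk (avoid (Some c)) x y e).
  elim: e y => [|e IH] y hd hw he.
    exists (fun=> (t, t)); split=> [k hk|c _]; first by lia.
    by rewrite has_walk0; apply/eqP/(dist_eq0 hd).
  have [z hz hzy] := dist_step hd.
  have hw1 : has_walk (avoid None) z t (d.+1 - e).
    have -> : d.+1 - e = 1 + (d.+1 - e.+1) by lia.
    by apply: has_walk_cat hw; rewrite has_walk1.
  have [f [f1 f2]] := IH _ hz hw1 (ltnW he).
  exists (fun k => if k == d.+1 - e.+1 then (z, y) else f k); split=> [k hk|c hc].
    case: eqP => [->|/eqP h]; last by apply: f1; lia.
    split=> /=; first by case/andP: hzy.
      apply/distP; split=> // j hj.
      have := dist_min E (has_walk_cat (dist_walk hd) hj); lia.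
    have -> : (d.+1 - e.+1).+1 = d.+1 - e by lia.
    apply/distP; split=> // j hj.
    have := dist_min E (has_walk_cat (dist_walk hz) hj); lia.
  rewrite -addn1; apply: (@has_walk_cat _ _ _ z).
    apply: f2 => k hk; have := hc k; case: (k =P d.+1 - e.+1) => [E'|_ h]; first by lia.
    by apply: h; lia.
  have := hc (d.+1 - e.+1); rewrite eqxx has_walk1 /avoid => hh.
  case/andP: hzy => -> _ /=; rewrite /alive; apply: contra (hh _) => [/eqP[->] //|]; lia.
have harc : (a.1, t) \in arcs by rewrite -h2 -surjective_pairing.
have hwa : has_walk (avoid None) a.1 t (d.+1 - d).
  have -> : d.+1 - d = 1 by lia.
  by rewrite has_walk1 /avoid harc.
have [f [f1 f2]] := sub2 _ _ h3 hwa (leqnSn d).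
(* The prefix up to [a.1] fills the indices from 1 on; index 0 is kept for the chosen arc [a]. *)
exists (fun k => if k == 0 then a else f k) => _ [<-].
split=> [k hk|c hc].
  case: eqP => [->|/eqP h]; last by apply: f1; lia.
  split=> //; first by rewrite h2 dist0.
  apply/distP; split; first by move: hwa; have -> : d.+1 - d = 1 by lia.
  move=> j hj; have := dist_min E (has_walk_cat (dist_walk h3) hj); lia.
rewrite ha; apply: last_arc_avoid ha _ E _.
  by have := hc 0 isT; rewrite /alive eqxx; apply: contra => /eqP[->].
apply: f2 => k hk; have := hc k; case: (k =P 0) => [E'|_ h]; first by lia.
by apply: h; lia.
Qed.

(** The failure-free last arcs form a shortest-path tree of [s]. If it avoids [c], all distances
    from [s] survive, so only colors of tree arcs need to be tried by the algorithm. *)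
Lemma last_arc_off_tree c s t :
  (forall v b, last_arc None s v = Some b -> col b != c) ->
  last_arc (Some c) s t = last_arc None s t.
Proof.
move=> htree.
have walk k u : dist (avoid None) s u = Some k -> has_walk (avoid (Some c)) s u k.
  elim: k u => [|k IH] u hu; first by rewrite has_walk0; apply/eqP/(dist_eq0 hu).
  have [b hb] := last_arc_ex hu; have [h1 h2 h3 [k' h4]] := last_arcP hb.
  rewrite hu => -[E]; subst k'.
  rewrite -addn1; apply: has_walk_cat (IH _ h4) _.
  rewrite has_walk1 /avoid -h2 -surjective_pairing h1 /alive.
  by apply: contra (htree _ _ hb) => /eqP[->].
case E: (last_arc None s t) => [a|].
  have [_ _ _ [k h1 h2]] := last_arcP E.
  apply: (last_arc_avoid E _ h2 (walk _ _ h1)).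
  by apply: contra (htree _ _ E) => /eqP[->].
(* Without failure [t] is either [s] itself or unreachable, and a failure creates no paths. *)
case E': (last_arc (Some c) s t) => [a|] //; have [_ _ _ [k _ h2]] := last_arcP E'.
have [[|j] _ hj] := dist_avoid h2; last by have [b] := last_arc_ex hj; rewrite E.
by move: h2; rewrite (dist_eq0 hj) dist0.
Qed.

End FirstArc.

(** * In-degrees of the preserver *)

(** Double counting of the incidences between vertices and sets: the maximal degree is at least the
    average degree. *)
Lemma popular_element (V : finType) (m : nat) (F : {set {set V}}) :
  (forall Z, Z \in F -> m <= #|Z|) -> 0 < m -> F != set0 ->
  exists v, m * #|F| <= #|V| * #|[set Z in F | v \in Z]|.
Proof.
move=> hF m0 /set0Pn[Z0 hZ0].
have /card_gt0P[v0 _] : 0 < #|Z0| by apply: leq_trans (hF _ hZ0).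
have [v _ hv] := @arg_maxnP V v0 predT (fun v => #|[set Z in F | v \in Z]|) isT.
exists v; rewrite mulnC -sum_nat_const.
apply: (@leq_trans (\sum_(Z in F) #|Z|)); first exact: leq_sum.
have -> : \sum_(Z in F) #|Z| = \sum_w #|[set Z in F | w \in Z]|.
  rewrite (eq_bigr (fun Z : {set V} => \sum_(w : V) (w \in Z : nat))); last first.
    by move=> Z _; rewrite -sum1_card big_mkcond; apply: eq_bigr => w _; case: (w \in Z).
  rewrite exchange_big; apply: eq_bigr => w _ /=.
  rewrite -sum1_card [RHS]big_mkcond [LHS]big_mkcond; apply: eq_bigr => Z _.
  by rewrite inE; case: (Z \in F); case: (w \in Z).
by rewrite -sum_nat_const; apply: leq_sum => w _; apply: hv.
Qed.

(** Greedy choice: a most popular vertex hits a fraction of at least m/|V| of the remaining sets, so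
    each round lowers ln|F| by at least that much; the extra 1 pays for the last round. *)
Lemma hitting_set (R : realType) (V : finType) (m : nat) (F : {set {set V}}) :
  (forall Z, Z \in F -> m <= #|Z|) -> 0 < m -> F != set0 ->
  exists2 X : {set V}, (forall Z, Z \in F -> exists2 y, y \in X & y \in Z) &
    (#|X|%:R * m%:R <= #|V|%:R * (1 + ln #|F|%:R) :> R)%R.
Proof.
have [N] := ubnP #|F|; elim: N => // N IH in F *; rewrite ltnS => hN hF m0 hF0.
have [v hv] := popular_element hF m0 hF0.
pose F' := [set Z in F | v \notin Z]; set a := #|[set Z in F | v \in Z]| in hv.
have hf : #|F| = a + #|F'|.
  rewrite -(cardsID [set Z : {set V} | v \in Z]); congr addn; apply: eq_card => Z; rewrite /F' !inE //.
  by rewrite andbC.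
have f0 : 0 < #|F| by rewrite card_gt0.
have hmV : m <= #|V|.
  by case/set0Pn: hF0 => Z /hF h; apply: leq_trans h (max_card _).
have a0 : 0 < a by case: (a) hv => //; nia.
have lnf : (0 <= ln #|F|%:R :> R)%R by rewrite ln_ge0 // ler1n.
have V0 : (0 <= #|V|%:R :> R)%R by [].
have [E|/set0Pn F'0] := eqVneq F' set0.
  exists [set v] => [Z hZ|].
    exists v; rewrite ?set11 //; have : Z \notin F' by rewrite E inE.
    by rewrite inE hZ negbK.
  have : (m%:R <= #|V|%:R :> R)%R by rewrite ler_nat.
  rewrite cards1; nra.
have hF'0 : F' != set0 by apply/set0Pn.
have [||X hX hc] := IH F' _ _ m0 hF'0; first by lia.
  by move=> Z; rewrite inE => /andP[/hF].
exists (v |: X) => [Z hZ|].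
  have [h|h] := boolP (v \in Z); first by exists v; rewrite ?setU11.
  have [|y h1 h2] := hX Z; first by rewrite inE hZ.
  by exists y => //; rewrite setU1r.
have f'0 : 0 < #|F'| by rewrite card_gt0.
have hle : (#|v |: X|%:R <= 1 + #|X|%:R :> R)%R.
  by rewrite -(natrD _ 1) ler_nat cardsU1; case: (_ \notin _).
have fR0 : (0 < #|F|%:R :> R)%R by rewrite ltr0n.
have f'R0 : (0 < #|F'|%:R :> R)%R by rewrite ltr0n.
have hfR : (#|F|%:R = a%:R + #|F'|%:R :> R)%R by rewrite hf natrD.
have hvR : (m%:R * #|F|%:R <= #|V|%:R * a%:R :> R)%R by rewrite -!natrM ler_nat.
(* This is ln(1 - z) <= -z with z = a/|F|, the fraction of sets just hit. *)
have hln : (ln #|F'|%:R - ln #|F|%:R <= - (a%:R / #|F|%:R) :> R)%R.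
  rewrite -ln_div ?posrE //.
  have -> : (#|F'|%:R / #|F|%:R = 1 + - (a%:R / #|F|%:R) :> R)%R.
    apply: (mulIf (lt0r_neq0 fR0)); rewrite mulrDl mulNr !divfK ?lt0r_neq0 // hfR; ring.
  apply: le_ln1Dx; rewrite ltrN2 ltr_pdivrMr // mul1r hfR; lra.
have hVa : (m%:R <= #|V|%:R * (a%:R / #|F|%:R) :> R)%R.
  by rewrite mulrA ler_pdivlMr.
have h1 : (#|V|%:R * (ln #|F'|%:R - ln #|F|%:R) <= #|V|%:R * - (a%:R / #|F|%:R) :> R)%R.
  exact: ler_wpM2l.
have h2 : (#|v |: X|%:R * m%:R <= (1 + #|X|%:R) * m%:R :> R)%R by exact: ler_wpM2r.
nra.
Qed.

Lemma card_some_image (I T : finType) (g : I -> option T) :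
  #|[set a | [exists k, g k == Some a]]| <= #|I|.
Proof.
have inj : injective (@Some T) by move=> x y [].
rewrite -(card_imset _ inj); apply: leq_trans (leq_imset_card g I).
apply/subset_leq_card/subsetP => _ /imsetP[a ha ->].
by move: ha; rewrite inE => /existsP[k /eqP<-]; apply: imset_f.
Qed.

(** * Counting the kept arcs into a fixed target *)

Section Target.
Variables (R : realType) (V : finType) (arcs : seq (V * V)) (col : V * V -> nat).
Variables (Delta q : nat) (S : {set V}) (t : V).
(** An undirected edge yields two opposite arcs of the same color; restricting to sets without
    opposite arcs keeps the bound [Delta] instead of twice that. *)
Hypothesis class_le : forall c (A : {set V * V}),
  (forall a, a \in A -> a \in arcs /\ col a = c) ->
  (forall a, a \in A -> (a.2, a.1) \notin A) -> #|A| <= Delta.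
Hypothesis q_gt0 : 0 < q.

Notation avoid := (avoid arcs col).
Notation last_arc := (last_arc arcs col).

Definition used_arcs : {set V * V} :=
  [set a | `[< exists s o, s \in S /\ last_arc o s t = Some a >]].

Lemma card_used_arcs : #|used_arcs| <= #|V|.
Proof.
rewrite -(@card_in_imset _ _ fst used_arcs) ?max_card // => a b.
rewrite !inE => /asboolP[s [o [_ /last_arcP[_ ha _ _]]]].
move=> /asboolP[s' [o' [_ /last_arcP[_ hb _ _]]]] h.
by rewrite (surjective_pairing a) (surjective_pairing b) h ha hb.
Qed.

(** Fixing one failure for each kept arc leaves one set to hit per arc, hence at most |V| sets,
    instead of one per pair of arc and color. *)
Lemma witness_ex : exists w : V * V -> option nat, forall a, a \in used_arcs ->
  exists2 s, s \in S & last_arc (w a) s t = Some a.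
Proof.
have /choice[w hw] : forall a, exists o, a \in used_arcs ->
    exists2 s, s \in S & last_arc o s t = Some a.
  move=> a; have [|_] := boolP (a \in used_arcs); last by exists None.
  by rewrite inE => /asboolP[s [o [h1 h2]]]; exists o => _; exists s.
by exists w.
Qed.

Definition near (w : V * V -> option nat) (m : nat) (a : V * V) : {set V} :=
  [set y | (last_arc (w a) y t == Some a) &&
           [exists k : 'I_m.+1, dist (avoid (w a)) y t == Some (k : nat)]].

(** [last_arc_level] supplies one vertex at each distance from 1 to [m], and different distances
    force different vertices. *)
Lemma card_near w m a x d : last_arc (w a) x t = Some a ->
  dist (avoid (w a)) x t = Some d -> m <= d -> m <= #|near w m a|.
Proof.
move=> h1 h2 hm.
have lev (k : 'I_m) : exists y, dist (avoid (w a)) y t = Some k.+1 /\ last_arc (w a) y t = Some a.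
  have [|y h3 h4] := last_arc_level (k := k.+1) h1 h2; last by exists y.
  by have := ltn_ord k; lia.
have [y hy] := choice lev.
rewrite -[X in X <= _]card_ord -(@card_imset _ _ y); last first.
  move=> i j hij; have [hi _] := hy i; have [hj _] := hy j.
  by move: hi; rewrite hij hj => -[/val_inj].
apply/subset_leq_card/subsetP => _ /imsetP[k _ ->]; rewrite inE.
have [h3 h4] := hy k; rewrite h4 eqxx; apply/existsP.
by exists (lift ord0 k); rewrite h3.
Qed.

(** Only the sets with at least [m] elements are given to the greedy algorithm. There are at most
    |V| of them, as kept arcs share the head [t]; this turns ln|F| into ln|V|. *)
Lemma hit_near w : exists X : nat -> {set V}, forall m, 0 < m ->
  (forall a, a \in used_arcs -> m <= #|near w m a| ->
     exists2 y, y \in X m & y \in near w m a) /\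
  (#|X m|%:R * m%:R <= #|V|%:R * (1 + ln #|V|%:R) :> R)%R.
Proof.
suff /choice[X hX] : forall m, exists X : {set V}, 0 < m ->
  (forall a, a \in used_arcs -> m <= #|near w m a| ->
     exists2 y, y \in X & y \in near w m a) /\
  (#|X|%:R * m%:R <= #|V|%:R * (1 + ln #|V|%:R) :> R)%R by exists X.
move=> m; case: (posnP m) => [->|m0]; first by exists set0.
pose F := [set near w m a | a in [set a | (a \in used_arcs) && (m <= #|near w m a|)]].
have hin a : a \in used_arcs -> m <= #|near w m a| -> near w m a \in F.
  by move=> h1 h2; apply: imset_f; rewrite in_set h1.
have [F0|F0] := eqVneq F set0.
  exists set0 => _; split=> [a h1 h2|]; first by have := hin _ h1 h2; rewrite F0 inE.
  rewrite cards0 mul0r; case: #|V| => [|n]; first by rewrite mul0r.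
  by rewrite mulr_ge0 // addr_ge0 // ln_ge0 // ler1n.
have hF Z : Z \in F -> m <= #|Z| by case/imsetP=> a; rewrite in_set => /andP[_ ?] ->.
have [X h1 h2] := hitting_set R hF m0 F0.
exists X => _; split=> [a h3 h4|]; first exact: h1 (hin _ h3 h4).
apply: le_trans h2 _; rewrite ler_wpM2l // lerD2l.
have hFV : #|F| <= #|V|.
  apply: leq_trans (leq_imset_card _ _) (leq_trans _ card_used_arcs).
  by apply/subset_leq_card/subsetP => a; rewrite in_set => /andP[].
have Fgt : 0 < #|F| by rewrite card_gt0.
by rewrite ler_ln ?posrE ?ltr0n ?ler_nat //; lia.
Qed.

Lemma card_used_arcs_bound :
  (#|used_arcs|%:R * q%:R <=
   2 * #|S|%:R * q%:R ^+ Delta.+1 + 2 * Delta%:R * (#|V|%:R * (1 + ln #|V|%:R)) :> R)%R.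
Proof.
have [w hw] := witness_ex.
have [X hX] := hit_near w.
have [f hf] := choice (fun x => spine_ex arcs col x t).
(* [g j x] lists the choices that [x] accounts for: [None] is the failure-free one, [Some k] the one
   where the color of the k-th arc from the end of its path fails. [B j] collects them over R_j. *)
pose Rj j := if j is i.+1 then X (q ^ (Delta - i)) else S.
pose g j x (k : option 'I_(q ^ (Delta - j))) :=
  if k is Some k' then last_arc (Some (col (f x k'))) x t else last_arc None x t.
pose B j := \bigcup_(x in Rj j) [set a | [exists k, g j x k == Some a]].
have cover : used_arcs \subset \bigcup_(j < Delta.+1) B j.
  apply/subsetP => a ha; have [//|/bigcupP hnB] := boolP (a \in _).
  have nB j x k : j <= Delta -> x \in Rj j -> g j x k != Some a.
    move=> hj hx; apply/eqP => hg; apply: hnB.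
    exists (inord j : 'I_Delta.+1) => //; rewrite inordK //.
    apply/bigcupP; exists x => //; rewrite inE; apply/existsP; exists k.
    by rewrite hg.
  have [s hs hsa] := hw a ha.
  case hc: (w a) => [c|]; last first.
    by have := nB 0 s None (leq0n _) hs; rewrite /g /= -hc hsa eqxx.
  (* An arc [a] in no [B j] is led to a contradiction by growing a set [A] of arcs of color [c].
     Distances of its members are failure-free, whereas [d] is measured after the failure of [c]. *)
  pose inv x d (A : {set V * V}) := [/\ last_arc (Some c) x t = Some a,
    dist (avoid (Some c)) x t = Some d &
    forall b, b \in A -> [/\ b \in arcs, col b = c & exists k, [/\ d <= k,
      dist (avoid None) b.2 t = Some k & dist (avoid None) b.1 t = Some k.+1]]].
  have step j x d A : j <= Delta -> x \in Rj j -> inv x d A -> #|A| = j ->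
      exists b k, [/\ b \in arcs, col b = c, q ^ (Delta - j) <= k < d &
        [/\ dist (avoid None) b.2 t = Some k, dist (avoid None) b.1 t = Some k.+1
          & #|b |: A| = j.+1]].
    move=> hj hx [h1 h2 h3] hA.
    have [d' hd' hd] := dist_avoid h2.
    have [hf1 hf2] := hf x d' hd.
    (* If [c] missed the path of [x], then [a] would be the failure-free choice, already in
       [B j]. *)
    have [k hk hkc] : exists2 k, k < d' & col (f x k) = c.
      apply: contrapT => hno.
      have := nB j x None hj hx; rewrite /g -(hf2 c) ?h1 ?eqxx // => k hk.
      by apply/eqP => E; apply: hno; exists k.
    have [e1 e2 e3] := hf1 k hk.
    have hkq : q ^ (Delta - j) <= k.
      rewrite leqNgt; apply/negP => hlt.
      by have := nB j x (Some (Ordinal hlt)) hj hx; rewrite /g /= hkc h1 eqxx.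
    exists (f x k), k; split=> //; first by rewrite hkq; lia.
    (* The new arc has its head at distance k < d' <= d, while heads of arcs in [A] are at distance
       at least [d]. *)
    split=> //; rewrite cardsU1 hA; case: (boolP (_ \in A)) => // hin.
    by have [_ _ [l [hl]]] := h3 _ hin; rewrite e2 => -[E] _; lia.
  have main j : j <= Delta -> exists x d A, [/\ x \in Rj j, inv x d A & #|A| = j].
    elim: j => [|j IH] hj.
      rewrite hc in hsa; have [_ _ _ [k _ hd]] := last_arcP hsa.
      exists s, k.+1, set0; rewrite cards0; split=> //; split=> // b.
      by rewrite inE.
    have [x [d [A [hx hi hA]]]] := IH (ltnW hj).
    have [b [k [b1 b2 b3 [b4 b5 b6]]]] := step _ _ _ _ (ltnW hj) hx hi hA.
    have [h1 h2 h3] := hi.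
    have m0 : 0 < q ^ (Delta - j) by rewrite expn_gt0 q_gt0.
    have [hit _] := hX _ m0.
    (* The near set is large enough because the threshold is at most k < d. The vertex [y] hitting
       it lies within the threshold, hence no farther from [t] than the head of [b]. *)
    have [|y hy] := hit a ha; first by apply: (@card_near _ _ _ x d); rewrite ?hc //; lia.
    rewrite inE hc => /andP[/eqP hya /existsP[k' /eqP hyk]].
    exists y, k', (b |: A); split=> //; split=> // b'.
    have hk' := ltn_ord k'.
    case/setU1P => [->|/h3[c1 c2 [l [c3 c4 c5]]]]; split=> //.
      by exists k; split=> //; lia.
    by exists l; split=> //; lia.
  have [x [d [A [hx hi hA]]]] := main _ (leqnn _).
  have [b [k [b1 b2 b3 [b4 b5 b6]]]] := step _ _ _ _ (leqnn _) hx hi hA.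
  have [h1 h2 h3] := hi.
  suff : #|b |: A| <= Delta by rewrite b6 ltnn.
  have hall b' : b' \in b |: A -> [/\ b' \in arcs, col b' = c & exists k,
      dist (avoid None) b'.2 t = Some k /\ dist (avoid None) b'.1 t = Some k.+1].
    case/setU1P => [->|/h3[c1 c2 [l [c3 c4 c5]]]]; split=> //; first by exists k.
    by exists l.
  (* Every collected arc leads one step closer to [t], so its reverse is not collected. *)
  apply: (class_le (c := c)) => b' /hall[c1 c2 [l [c3 c4]]] //.
  apply/negP => /hall[_ _ [l' [/=]]]; rewrite c3 c4 => -[E1] [E2]; lia.
have hB j : #|B j| <= #|Rj j| * (q ^ (Delta - j)).+1.
  apply: leq_trans (_ : \sum_(x in Rj j) (q ^ (Delta - j)).+1 <= _); last first.
    by rewrite sum_nat_const.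
  rewrite /B; elim/big_rec2: _ => [|x m A _ h]; first by rewrite cards0.
  apply: leq_trans (leq_card_setU _ _) (leq_add _ h).
  by apply: leq_trans (card_some_image _) _; rewrite card_option card_ord.
have hU : #|used_arcs| <= \sum_(j < Delta.+1) #|Rj j| * (q ^ (Delta - j)).+1.
  apply: leq_trans (subset_leq_card cover) _.
  elim/big_rec2: _ => [|j m A _ h]; first by rewrite cards0.
  exact: leq_trans (leq_card_setU _ _) (leq_add (hB _) h).
have hU' : (#|used_arcs|%:R * q%:R <=
    (\sum_(j < Delta.+1) #|Rj j| * (q ^ (Delta - j)).+1)%N%:R * q%:R :> R)%R.
  by rewrite ler_wpM2r // ler_nat.
apply: le_trans hU' _; rewrite big_ord_recl natrD mulrDl subn0; apply: lerD.
  rewrite -natrX -!natrM ler_nat expnSr /=.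
  have : 0 < q ^ Delta by rewrite expn_gt0 q_gt0.
  nia.
set K := (#|V|%:R * _)%R.
(* For R_(j+1) the successor at most doubles the next power of q, and the factor q lifts it to
   q^(Delta - j), the threshold for which R_(j+1) was chosen. *)
have hterm (j : 'I_Delta) : ((#|Rj (lift ord0 j)| * (q ^ (Delta - lift ord0 j)).+1)%N%:R * q%:R <= 2 * K :> R)%R.
  have hm : Delta - j = (Delta - j.+1).+1 by have := ltn_ord j; lia.
  have m0 : 0 < q ^ (Delta - j) by rewrite expn_gt0 q_gt0.
  have [_ hK] := hX _ m0.
  have hK2 : (2 * (#|X (q ^ (Delta - j))%N|%:R * (q ^ (Delta - j))%N%:R) <= 2 * K :> R)%R.
    by rewrite ler_wpM2l.
  apply: le_trans hK2.
  rewrite -!natrM ler_nat [lift _ _ : nat]/= /bump /= add1n.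
  set Y := #|_|; rewrite hm expnSr.
  have : 0 < q ^ (Delta - j.+1) by rewrite expn_gt0 q_gt0.
  nia.
rewrite natr_sum mulr_suml; apply: le_trans (ler_sum _ (fun j _ => hterm j)) _.
rewrite sumr_const card_ord -mulr_natr le_eqVlt; apply/orP; left; apply/eqP; ring.
Qed.

End Target.

(** * The preserver of a colored graph *)

Section Bound.
Local Open Scope ring_scope.

(** With K = 1/ln 2 this is 2 + 4 (K + 1): 2 from the sources and 4 (K + 1) from the hitting sets,
    where K + 1 absorbs 1 + ln n into ln n and a factor 2 pays for rounding q. *)
Definition bound_const (R : realType) : R := 6 + 4 / ln 2.

Lemma ln_le_mul_const (R : realType) (n : nat) : (2 <= n)%N ->
  0 < ln n%:R :> R /\ 1 <= (ln 2)^-1 * ln n%:R :> R.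
Proof.
move=> n2; have l2 : 0 < ln 2 :> R by rewrite ln_gt0 // ltr1n.
have le2 : ln 2 <= ln n%:R :> R by rewrite ler_ln ?posrE ?ltr0n ?ler_nat //; lia.
split; first by apply: lt_le_trans le2.
by rewrite mulrC ler_pdivlMr // mul1r.
Qed.

(* [q] is chosen to balance the two terms of [hq]. *)
Lemma optimize_threshold (R : realType) (n s Delta N : nat) :
  (2 <= n)%N -> (1 <= s)%N -> (1 <= Delta)%N -> (N <= n * n)%N ->
  (forall q : nat, (0 < q)%N -> N%:R * q%:R <=
    n%:R * (2 * s%:R * q%:R ^+ Delta.+1 + 2 * Delta%:R * (n%:R * (1 + ln n%:R))) :> R) ->
  N%:R <= bound_const R * size_bound R Delta n s.
Proof.
move=> n2 s1 d1 hN hq.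
have [L0 hK] := ln_le_mul_const R n2.
set L := ln n%:R in hq L0 hK; set K := (ln 2)^-1 in hK.
have K0 : 0 < K by rewrite invr_gt0 ln_gt0 // ltr1n.
pose a : R := Delta.+1%:R^-1.
have n0 : 0 < n%:R :> R by rewrite ltr0n; lia.
have s0 : 0 < s%:R :> R by rewrite ltr0n.
have d0 : 1 <= Delta%:R :> R by rewrite ler1n.
(* The real optimum q0 solves s q0^(Delta + 1) = n L; then the size bound equals n Delta D with D =
   s q0^Delta. *)
pose y : R := n%:R * L / s%:R.
have y0 : 0 < y by rewrite divr_gt0 // mulr_gt0.
pose q0 : R := y `^ a.
have q0_gt0 : 0 < q0 by rewrite powR_gt0.
have q0y : q0 ^+ Delta.+1 = y.
  by rewrite -powR_mulrn ?powR_ge0 // -powRrM mulVf ?pnatr_eq0 // powRr1 // ltW.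
pose D : R := s%:R * q0 ^+ Delta.
have D0 : 0 < D by rewrite mulr_gt0 // exprn_gt0.
have Dq0 : D * q0 = n%:R * L.
  by rewrite /D -mulrA -exprSr q0y mulrC divfK // gt_eqF.
have hD : size_bound R Delta n s = n%:R * Delta%:R * D.
  have a1 : 0 < a by rewrite invr_gt0 ltr0n.
  have ha : a * Delta%:R = 1 - a.
    by rewrite /a -[Delta.+1]addn1 natrD; field; rewrite -(natrD _ _ 1) pnatr_eq0 addn1.
  have nn : n%:R != 0 :> R by rewrite gt_eqF.
  have sn : s%:R != 0 :> R by rewrite gt_eqF.
  rewrite /size_bound -/a -/L.
  have -> : D = s%:R `^ a * n%:R `^ (1 - a) * L `^ (1 - a).
    rewrite /D -powR_mulrn ?powR_ge0 // -powRrM ha /y.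
    have -> : n%:R * L / s%:R = s%:R^-1 * (n%:R * L) by rewrite mulrC.
    rewrite powRM ?invr_ge0 ?mulr_ge0 ?ltW // powRM ?ltW // !mulrA; congr (_ * _ * _).
    rewrite -powR_inv1 ?ltW // -powRrM mulN1r opprB.
    rewrite -{1}(powRr1 (ltW s0)) -powRD ?sn ?implybT //; congr (_ `^ _); lra.
  have -> : n%:R `^ (2 - a) = n%:R * n%:R `^ (1 - a).
    rewrite -{2}(powRr1 (ltW n0)) -powRD ?nn ?implybT //; congr (_ `^ _); lra.
  ring.
rewrite hD /bound_const -/K.
(* If q0 >= 1, rounding down loses at most a factor 2. Otherwise D >= D q0 = n L, and the trivial
   bound N <= n^2 suffices. *)
have [q01|q01] := leP 1 q0.
  have [q hq1] : exists q : nat, (q%:R <= q0 < q.+1%:R).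
    by exists (Num.truncn q0); apply: truncn_itv; rewrite ltW.
  move: hq1 => /andP[hq1 hq2].
  have qn0 : (0 < q)%N.
    by rewrite lt0n; apply/eqP => E; move: hq2; rewrite E ltNge q01.
  have q1 : 1 <= q%:R :> R by rewrite ler1n.
  have hq3 : q0 <= 2 * q%:R by move: hq2; rewrite -addn1 natrD; lra.
  have := hq q qn0; rewrite exprSr => h.
  have hpow : q%:R ^+ Delta <= q0 ^+ Delta by apply: lerXn2r; rewrite ?nnegrE ?ler0n ?(ltW q0_gt0).
  have h1 : s%:R * q%:R ^+ Delta <= D by rewrite /D ler_wpM2l // ltW.
  have h2 : n%:R * (1 + L) <= (K + 1) * (D * (2 * q%:R)).
    have e1 : 1 + L <= (K + 1) * L by lra.
    apply: (@le_trans _ _ ((K + 1) * (n%:R * L))).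
      by rewrite mulrCA ler_wpM2l // ltW.
    apply: ler_wpM2l; first by lra.
    by rewrite -Dq0; apply: ler_wpM2l => //; exact: ltW.
  have q_gt0 : 0 < q%:R :> R by lra.
  rewrite -(ler_pM2r q_gt0); apply: le_trans h _.
  have -> : (6 + 4 * K) * (n%:R * Delta%:R * D) * q%:R =
      n%:R * (((6 + 4 * K) * (Delta%:R * D)) * q%:R) by ring.
  rewrite ler_wpM2l ?(ltW n0) //.
  have h3 : 2 * s%:R * (q%:R ^+ Delta * q%:R) <= 2 * (Delta%:R * D) * q%:R.
    rewrite !mulrA -(mulrA 2) ler_wpM2r ?(ltW q_gt0) // -!mulrA ler_wpM2l //.
    by apply: le_trans h1 _; rewrite ler_peMl // ltW.
  have h4 : 2 * Delta%:R * (n%:R * (1 + L)) <= 2 * Delta%:R * ((K + 1) * (D * (2 * q%:R))).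
    by rewrite ler_wpM2l // mulr_ge0.
  apply: le_trans (lerD h3 h4) _.
  rewrite le_eqVlt; apply/orP; left; apply/eqP; ring.
have hDL : n%:R * L <= D.
  by rewrite -Dq0 ler_piMr // ltW.
have hN' : N%:R <= n%:R * n%:R :> R by rewrite -natrM ler_nat.
apply: le_trans hN' _.
have h1 : n%:R <= K * D.
  apply: le_trans (_ : K * (n%:R * L) <= _); last by rewrite ler_wpM2l // ltW.
  by rewrite mulrCA ler_peMr // ltW.
have h2 : K * D <= (6 + 4 * K) * (Delta%:R * D).
  have -> : (6 + 4 * K) * (Delta%:R * D) = (6 + 4 * K) * Delta%:R * D by ring.
  by apply: ler_wpM2r; [exact: ltW | nra].
have -> : (6 + 4 * K) * (n%:R * Delta%:R * D) = n%:R * ((6 + 4 * K) * (Delta%:R * D)) by ring.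
by rewrite ler_wpM2l ?(ltW n0) //; apply: le_trans h2.
Qed.

End Bound.

(** * From arcs back to the edges of the graph *)

Section Preserver.
Variables (n : nat) (G : cgraph n) (es : seq ('I_n * 'I_n)).
Hypothesis es_edges : es =i edges G.

(** The reversed copies come after all edges, so that arc m + i is the reverse of edge i; the
    program uses the same layout. *)
Definition graph_arcs : seq ('I_n * 'I_n) :=
  es ++ (if directed G then [::] else [seq (e.2, e.1) | e <- es]).

Definition stored (a : 'I_n * 'I_n) :=
  if directed G || (a.1 < a.2) then a else (a.2, a.1).

Definition arc_color a := color G (stored a).

Notation avoid := (avoid graph_arcs arc_color).
Notation last_arc := (last_arc graph_arcs arc_color).

Lemma adj_stored (X : {set 'I_n * 'I_n}) x y : X \subset edges G ->
  adj G X x y = (stored (x, y) \in X).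
Proof.
move=> /subsetP hX; rewrite /adj /stored /=; case: ifPn => [|hd].
  case: (directed G) (fun e h => edges_wf (hX e h)) => hwf /=; first by rewrite orbF.
  move=> hxy; case h: ((y, x) \in X); last by rewrite orbF.
  have := hwf _ h => /=; lia.
move: hd (fun e h => edges_wf (hX e h)); rewrite negb_or => /andP[/negbTE-> hxy] hwf /=.
by case h: ((x, y) \in X) => //; have := hwf _ h; rewrite /= (negbTE hxy).
Qed.

Lemma adj_edges_arcs x y : adj G (edges G) x y = ((x, y) \in graph_arcs).
Proof.
rewrite /adj /graph_arcs mem_cat es_edges; case: (directed G) => //=.
congr orb; rewrite -es_edges; apply/idP/mapP => [h|[[a b] h [-> ->]]] //.
by exists (y, x).
Qed.

Lemma mem_graph_arcs a : (a \in graph_arcs) = (stored a \in edges G).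
Proof. by case: a => x y; rewrite -adj_edges_arcs adj_stored. Qed.

Lemma stored_edge e : e \in edges G -> stored e = e.
Proof.
move=> /edges_wf; rewrite /stored; case: (directed G) => //= -> //.
Qed.

Definition failed (o : option nat) : {fset nat} :=
  if o is Some c then [fset c]%fset else fset0.

Lemma failed_ex (F : {fset nat}) : #|` F|%fset <= 1 -> exists o, F = failed o.
Proof.
case E: #|` F|%fset => [|[|]] // _; first by exists None; apply/cardfs0_eq.
have /cardfs1P[c ->] : #|` F|%fset == 1 by rewrite E.
by exists (Some c).
Qed.

Lemma adj_removeE (X : {set 'I_n * 'I_n}) o x y : X \subset edges G ->
  adj G (remove_colors G X (failed o)) x y =
  (stored (x, y) \in X) && alive arc_color o (x, y).
Proof.
move=> hX; rewrite adj_stored; last first.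
  by apply: subset_trans hX; apply/subsetP => e; rewrite inE => /andP[].
rewrite inE /alive /failed; case: o => [c|]; last by rewrite inE.
by rewrite inE /arc_color; congr (_ && ~~ _); apply/eqP/eqP => [->|[->]].
Qed.

(** Tracing last arcs back from [t] gives a shortest path from [s] made of kept arcs only, by
    induction on the distance. *)
Lemma preserver_of_last_arcs (S : {set 'I_n}) (H : {set 'I_n * 'I_n}) :
  H \subset edges G ->
  (forall o s t a, s \in S -> last_arc o s t = Some a -> stored a \in H) ->
  cft_preserver 1 G (setX S [set: 'I_n]) H.
Proof.
move=> hH hlast; split=> // F /failed_ex[o ->] s t; rewrite inE /= => /andP[hs _].
have -> : dist (adj G (remove_colors G (edges G) (failed o))) s t = dist (avoid o) s t.
  by apply: eq_dist => x y; rewrite adj_removeE // avoidE mem_graph_arcs.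
set rH := adj _ _.
have rHE x y : rH x y = (stored (x, y) \in H) && alive arc_color o (x, y).
  by rewrite /rH adj_removeE.
have sub : subrel rH (avoid o).
  move=> x y; rewrite rHE avoidE mem_graph_arcs => /andP[h ->].
  by rewrite (subsetP hH).
have walk k u : dist (avoid o) s u = Some k -> has_walk rH s u k.
  elim: k u => [|k IH] u h; first by rewrite has_walk0 (dist_eq0 h).
  have [a ha] := last_arc_ex h; have [_ h2 h3 [k']] := last_arcP ha.
  rewrite h => h4 [E]; subst k'.
  rewrite -addn1; apply: has_walk_cat (IH _ h4) _.
  by rewrite has_walk1 rHE -h2 -surjective_pairing h3 (hlast _ _ _ _ hs ha).
case E: (dist (avoid o) s t) => [k|]; last first.
  case E': (dist rH s t) => [k|] //.
  have [j _] := dist_ex (has_walk_sub sub (dist_walk E')).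
  by rewrite E.
apply/distP; split; first exact: walk.
by move=> j hj; apply: dist_min E _; apply: has_walk_sub hj.
Qed.

Definition preserver (S : {set 'I_n}) : {set 'I_n * 'I_n} :=
  \bigcup_t [set stored a | a in used_arcs graph_arcs arc_color S t].

Lemma preserverP (S : {set 'I_n}) e : reflect
  (exists o s t a, [/\ s \in S, last_arc o s t = Some a & stored a = e])
  (e \in preserver S).
Proof.
apply: (iffP bigcupP) => [[t _ /imsetP[a]]|[o [s [t [a [h1 h2 <-]]]]]].
  by rewrite inE => /asboolP[s [o [h1 h2]]] ->; exists o, s, t, a.
by exists t => //; apply: imset_f; rewrite inE; apply/asboolP; exists s, o.
Qed.

(** [stored] is injective on a set without opposite arcs and maps it into a color class. *)
Lemma color_class_arcs Delta (hD : forall c, #|color_class G c| <= Delta)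
    c (A : {set 'I_n * 'I_n}) :
  (forall a, a \in A -> a \in graph_arcs /\ arc_color a = c) ->
  (forall a, a \in A -> (a.2, a.1) \notin A) -> #|A| <= Delta.
Proof.
move=> hA hanti; apply: leq_trans (hD c); rewrite -(@card_in_imset _ _ stored A).
  apply/subset_leq_card/subsetP => _ /imsetP[a ha ->]; have [h1 h2] := hA _ ha.
  by rewrite inE -mem_graph_arcs h1 -h2 eqxx.
move=> [x y] [x' y'] ha hb; rewrite /stored /=.
have ha' := hanti _ ha; have hb' := hanti _ hb; rewrite /= in ha' hb'.
case: ifP => _; case: ifP => _ // -[E1 E2]; subst; last by [].
  by rewrite ha in hb'.
by rewrite hb in ha'.
Qed.

Lemma preserver_good (R : realType) Delta (S : {set 'I_n}) :
  1 <= Delta -> (forall c, #|color_class G c| <= Delta) ->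
  cft_preserver 1 G (setX S [set: 'I_n]) (preserver S) /\
  (#|preserver S|%:R <= bound_const R * size_bound R Delta n #|S|)%R.
Proof.
move=> d1 hD; split.
  apply: preserver_of_last_arcs => [|o s t a hs ha].
    apply/subsetP => e /preserverP[o [s [t [a [_ /last_arcP[h _ _ _] <-]]]]].
    by rewrite -mem_graph_arcs.
  by apply/preserverP; exists o, s, t, a.
have sz0 : (0 <= bound_const R * size_bound R Delta n #|S|)%R.
  rewrite mulr_ge0 // /bound_const ?addr_ge0 ?divr_ge0 ?ln_ge0 ?ler1n //.
  by rewrite /size_bound !mulr_ge0 ?powR_ge0.
(* The optimization needs n >= 2, for ln n > 0, and a nonempty [S]; the remaining cases have no last
   arcs. *)
have triv : (n <= 1) || (#|S| == 0) -> preserver S = set0.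
  move=> h; apply/setP => e; rewrite [RHS]inE; apply/negP.
  case/preserverP=> o [s [t [a [hs ha _]]]]; have [harc _ _ _] := last_arcP ha.
  case/orP: h => h; last by move: hs; rewrite (cards0_eq (eqP h)) inE.
  have hsub (x y : 'I_n) : x = y.
    by apply: val_inj; have := ltn_ord x; have := ltn_ord y; rewrite /=; lia.
  rewrite mem_graph_arcs in harc; have := edges_wf harc.
  rewrite (hsub (stored a).2 (stored a).1) eqxx ltnn; by case: directed.
case: (leqP n 1) => [n1|n2]; first by rewrite triv ?n1 // cards0.
have [S0|S0] := eqVneq #|S| 0; first by rewrite triv ?cards0 // S0 orbT.
rewrite -lt0n in S0.
have hle t : #|[set stored a | a in used_arcs graph_arcs arc_color S t]| <=
    #|used_arcs graph_arcs arc_color S t| by exact: leq_imset_card.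
have hsum : #|preserver S| <= \sum_t #|used_arcs graph_arcs arc_color S t|.
  rewrite /preserver; elim/big_rec2: _ => [|t m A _ h]; first by rewrite cards0.
  exact: leq_trans (leq_card_setU _ _) (leq_add (hle t) h).
apply: optimize_threshold => //.
  apply: leq_trans hsum _; apply: (@leq_trans (\sum_(t < n) n)).
    apply: leq_sum => t _.
    by have := card_used_arcs graph_arcs arc_color S t; rewrite card_ord.
  by rewrite sum_nat_const card_ord.
move=> q q0.
have hq t := @card_used_arcs_bound R _ graph_arcs arc_color Delta q S t
  (color_class_arcs hD) q0.
apply: (@le_trans _ _ ((\sum_(t < n) #|used_arcs graph_arcs arc_color S t|)%N%:R * q%:R)%R).
  by rewrite ler_wpM2r // ler_nat.
rewrite natr_sum mulr_suml; apply: le_trans (ler_sum _ (fun t _ => hq t)) _.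
by rewrite sumr_const !card_ord [leRHS]mulr_natl.
Qed.

End Preserver.

(** * Total correctness and running time of programs *)

Section Runs.
Variable W : nat.

Definition runs (c : cmd) (st : state) (B : nat) (Q : state -> Prop) : Prop :=
  exists t st', [/\ exec W c st t st', t <= B & Q st'].

Lemma runs_weaken c st B B' (Q Q' : state -> Prop) :
  runs c st B Q -> B <= B' -> (forall st', Q st' -> Q' st') -> runs c st B' Q'.
Proof.
move=> [t [st' [h1 h2 h3]]] hB hQ; exists t, st'; split=> //; last exact: hQ.
exact: leq_trans hB.
Qed.

Lemma runs_le c st B B' (Q : state -> Prop) : runs c st B Q -> B <= B' -> runs c st B' Q.
Proof. by move=> h hB; apply: runs_weaken h hB _. Qed.

Lemma runs_seq p1 p2 st B1 B2 Q1 Q :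
  runs p1 st B1 Q1 -> (forall st', Q1 st' -> runs p2 st' B2 Q) ->
  runs (Seq p1 p2) st (B1 + B2) Q.
Proof.
move=> [t1 [st1 [h1 h2 /[swap] /[apply]]]] [t2 [st2 [h4 h5 h6]]].
exists (t1 + t2), st2; split=> //; last exact: leq_add.
exact: ExecSeq h1 h4.
Qed.

Lemma runs_if e p1 p2 st B Q :
  (eval W st e != 0 -> runs p1 st B Q) -> (eval W st e = 0 -> runs p2 st B Q) ->
  runs (If e p1 p2) st (ecost e + B).+1 Q.
Proof.
move=> h1 h2; have [E|E] := eqVneq (eval W st e) 0.
  have [t [st' [e1 e2 e3]]] := h2 E; exists (ecost e + t).+1, st'.
  by split=> //; [apply: ExecIfFalse | rewrite ltnS leq_add2l].
have [t [st' [e1 e2 e3]]] := h1 E; exists (ecost e + t).+1, st'.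
by split=> //; [apply: ExecIfTrue | rewrite ltnS leq_add2l].
Qed.

(* [I phi st] says that the loop can be completed from [st] within [phi] units. *)
Lemma runs_while e p (I : nat -> state -> Prop) Q phi st :
  (forall phi st, I phi st -> eval W st e != 0 ->
     exists b phi', b + (ecost e).+1 + phi' <= phi /\ runs p st b (I phi')) ->
  (forall phi st, I phi st -> eval W st e = 0 -> ecost e < phi /\ Q st) ->
  I phi st -> runs (While e p) st phi Q.
Proof.
move=> hstep hdone; have [N] := ubnP phi; elim: N phi st => // N IH phi st hN hI.
have [E|E] := eqVneq (eval W st e) 0.
  have [h1 h2] := hdone _ _ hI E; exists (ecost e).+1, st; split=> //.
  exact: ExecWhileFalse.
have [b [phi' [hb [t [st1 [h1 h2 h3]]]]]] := hstep _ _ hI E.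
have [|t' [st2 [e1 e2 e3]]] := IH _ _ _ h3; first by lia.
exists (ecost e + t + t').+1, st2; split=> //; last by lia.
exact: ExecWhileTrue h1 e1.
Qed.

(** The potential is the cost of the remaining rounds. The budget depends on the round because in
    the loop over tree arcs only some rounds run a search. *)
Lemma runs_for e p (I : nat -> state -> Prop) N b st :
  (forall k st, k < N -> I k st -> eval W st e != 0 /\ runs p st (b k) (I k.+1)) ->
  (forall st, I N st -> eval W st e = 0) ->
  I 0 st ->
  runs (While e p) st (\sum_(k < N) (b k + (ecost e).+1) + (ecost e).+1) (I N).
Proof.
move=> hstep hdone h0.
apply: (@runs_while _ _ (fun phi st => exists k, [/\ k <= N, I k st &
   phi = \sum_(k <= j < N) (b j + (ecost e).+1) + (ecost e).+1])); last first.
  by exists 0; split=> //; rewrite big_mkord.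
  move=> _ st' [k [hk hI ->]] E; split; first by lia.
  move: hk; rewrite leq_eqVlt => /orP[/eqP<- //|hk].
  by have [] := hstep _ _ hk hI; rewrite E.
move=> _ st' [k [hk hI ->]] E.
have {hk} hk : k < N.
  move: hk; rewrite leq_eqVlt => /orP[/eqP h|//].
  by move: E; rewrite (hdone _ _) // -h.
have [_ hr] := hstep _ _ hk hI.
exists (b k), (\sum_(k.+1 <= j < N) (b j + (ecost e).+1) + (ecost e).+1).
split; first by rewrite [X in _ <= X + _]big_ltn // !addnA.
by apply: runs_weaken hr _ _ => // st'' h; exists k.+1.
Qed.

(** * Loop-free code by symbolic evaluation *)

Fixpoint loop_free (c : cmd) : bool :=
  match c with
  | Seq p1 p2 | If _ p1 p2 => loop_free p1 && loop_free p2
  | While _ _ => false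
  | _ => true
  end.

(* Result and cost bound of loop-free code; the value on loops is junk. *)
Fixpoint interp (c : cmd) (st : state) : state :=
  match c with
  | Skip => st
  | SetReg i e => set_reg st i (eval W st e)
  | SetArr a e1 e2 => set_arr st a (eval W st e1) (eval W st e2)
  | Seq p1 p2 => interp p2 (interp p1 st)
  | If e p1 p2 => if eval W st e == 0 then interp p2 st else interp p1 st
  | While _ _ => st
  end.

Fixpoint cost_bound (c : cmd) : nat :=
  match c with
  | Skip => 1
  | SetReg _ e => (ecost e).+1
  | SetArr _ e1 e2 => (ecost e1 + ecost e2).+1
  | Seq p1 p2 => cost_bound p1 + cost_bound p2
  | If e p1 p2 => (ecost e + (cost_bound p1 + cost_bound p2)).+1
  | While _ _ => 0
  end.

Lemma runs_loop_free c st (Q : state -> Prop) :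
  loop_free c -> Q (interp c st) -> runs c st (cost_bound c) Q.
Proof.
elim: c st Q => [|i e|a e1 e2|p1 IH1 p2 IH2|e p1 IH1 p2 IH2|] st Q //=.
- by move=> _ h; exists 1, st; split=> //; apply: ExecSkip.
- by move=> _ h; eexists _, _; split; [apply: ExecSetReg | | apply: h].
- by move=> _ h; eexists _, _; split; [apply: ExecSetArr | | apply: h].
- move=> /andP[h1 h2] h.
  apply: (@runs_seq _ _ _ _ _ (fun st' => st' = interp p1 st)); first exact: IH1.
  by move=> _ ->; apply: IH2.
move=> /andP[h1 h2]; case: eqP => E h.
  apply: runs_if => [|_]; first by rewrite E.
  by apply: runs_weaken (IH2 _ _ h2 h) _ _ => //; apply: leq_addl.
apply: runs_if => // _.
by apply: runs_weaken (IH1 _ _ h1 h) _ _ => //; apply: leq_addr.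
Qed.

Lemma runs_free_seq p1 p2 st B Q :
  loop_free p1 -> runs p2 (interp p1 st) B Q ->
  runs (Seq p1 p2) st (cost_bound p1 + B) Q.
Proof.
move=> h1 h2; apply: (@runs_seq _ _ _ _ _ (fun st' => st' = interp p1 st)).
  exact: runs_loop_free.
by move=> _ ->.
Qed.

(** * Frame conditions, read off the syntax *)

Fixpoint written_regs (c : cmd) : seq nat :=
  match c with
  | SetReg i _ => [:: i]
  | Seq p1 p2 | If _ p1 p2 => written_regs p1 ++ written_regs p2
  | While _ p => written_regs p
  | _ => [::]
  end.

Fixpoint written_arrs (c : cmd) : seq nat :=
  match c with
  | SetArr a _ _ => [:: a]
  | Seq p1 p2 | If _ p1 p2 => written_arrs p1 ++ written_arrs p2
  | While _ p => written_arrs p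
  | _ => [::]
  end.

Definition same_outside (c : cmd) (st st' : state) : Prop :=
  (forall i, i \notin written_regs c -> reg st' i = reg st i) /\
  (forall a j, a \notin written_arrs c -> arr st' a j = arr st a j).

Lemma exec_frame c st t st' : exec W c st t st' -> same_outside c st st'.
Proof.
elim=> {c st t st'} //=.
- by move=> st i e; split=> //= j; rewrite inE => /negbTE->.
- by move=> st a e1 e2; split=> //= b j; rewrite inE => /negbTE->.
- move=> p1 p2 st st1 st2 t1 t2 _ [h1 h2] _ [h3 h4].
  by split=> [i|a j] /=; rewrite mem_cat negb_or => /andP[h h']; rewrite ?h3 ?h1 ?h4 ?h2.
- move=> e p1 p2 st st' t _ _ [h1 h2].
  by split=> [i|a j] /=; rewrite mem_cat negb_or => /andP[h h']; rewrite ?h1 ?h2.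
- move=> e p1 p2 st st' t _ _ [h1 h2].
  by split=> [i|a j] /=; rewrite mem_cat negb_or => /andP[h h']; rewrite ?h1 ?h2.
move=> e p st st1 st2 t1 t2 _ _ [h1 h2] _ [h3 h4].
by split=> [i|a j] /= h; rewrite ?h3 ?h1 ?h4 ?h2.
Qed.

Lemma runs_frame c st B Q : runs c st B Q ->
  runs c st B (fun st' => Q st' /\ same_outside c st st').
Proof.
move=> [t [st' [h1 h2 h3]]]; exists t, st'; split=> //; split=> //.
exact: exec_frame h1.
Qed.

End Runs.

(** * Breadth-first search *)

Section BfsInvariant.
Variables (V : finType) (r : rel V) (s : V).

(* [D v] is one more than the distance found for [v], or 0; the first [h]
   vertices of the queue [q] have been scanned. *)
Record bfs_inv (q : seq V) (h : nat) (D : V -> nat) : Prop := BfsInv {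
  bfs_uniq : uniq q;
  bfs_mem : forall v, (v \in q) = (D v != 0);
  bfs_walk : forall v k, D v = k.+1 -> has_walk r s v k;
  bfs_sorted : pairwise leq [seq D v | v <- q];
  bfs_window : forall v, h < size q -> D v <= (D (nth s q h)).+1;
  bfs_closed : forall i w, i < h -> r (nth s q i) w -> 0 < D w <= (D (nth s q i)).+1;
  bfs_small : forall v, D v <= size q;
  bfs_source : D s = 1;
  bfs_head : h <= size q }.

Lemma bfs_inv_init : bfs_inv [:: s] 0 (fun v => v == s).
Proof.
split=> //= [v|v k|v _|v|]; rewrite ?inE ?eqxx ?eqb0 ?negbK //; try by case: eqP.
by case: eqP => // -> [<-]; rewrite has_walk0.
Qed.

Lemma bfs_size q h D : bfs_inv q h D -> size q <= #|V|.
Proof. by move=> /bfs_uniq/card_uniqP<-; apply: max_card. Qed.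

(** The new value is one more than that of the head, which by [bfs_window] is the largest possible,
    so the queue stays sorted. *)
Lemma bfs_inv_push q h D w : bfs_inv q h D -> h < size q ->
  r (nth s q h) w -> D w = 0 ->
  bfs_inv (rcons q w) h (fun v => if v == w then (D (nth s q h)).+1 else D v).
Proof.
move=> [h1 h2 h3 h4 h5 h6 h7 h8 h9] hh hr hw.
have wq : w \notin q by rewrite h2 hw.
have nthq i : i < size q -> nth s (rcons q w) i = nth s q i.
  by move=> hi; rewrite nth_rcons hi.
have neqw i : i < size q -> (nth s q i == w) = false.
  by move=> hi; apply: contraNF wq => /eqP<-; rewrite mem_nth.
have hD0 v : v \in q -> (v == w) = false by move=> hv; apply: contraNF wq => /eqP<-.
have hu : D (nth s q h) != 0 by rewrite -h2 mem_nth.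
split.
- by rewrite rcons_uniq wq.
- by move=> v; rewrite mem_rcons inE; case: eqP => //= _; rewrite h2.
- move=> v k; case: eqP => [-> [<-]|_]; last exact: h3.
  case E: (D (nth s q h)) hu => [|j] // _.
  by rewrite -addn1; apply: has_walk_cat (h3 _ _ E) _; rewrite has_walk1.
- rewrite map_rcons eqxx pairwise_rcons.
  have -> : [seq (if v == w then (D (nth s q h)).+1 else D v) | v <- q] = [seq D v | v <- q].
    by apply/eq_in_map => v /hD0 ->.
  rewrite h4 andbT; apply/allP => _ /mapP[v hv ->]; exact: h5.
- move=> v _; rewrite nthq // neqw //; case: eqP => // _; exact: h5.
- move=> i v hi; rewrite nthq; last by lia.
  rewrite neqw; last by lia.
  by move=> hri; have := h6 _ _ hi hri; case: eqP => // ->; rewrite hw.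
- move=> v; rewrite size_rcons; case: eqP => _; first by rewrite ltnS h7.
  exact: leqW.
- by case: eqP => // E; move: hw; rewrite -E h8.
by rewrite size_rcons leqW.
Qed.

(** By sortedness the next head has no smaller value, so the window bound persists; the same bound
    makes the scanned head closed. *)
Lemma bfs_inv_next q h D : bfs_inv q h D -> h < size q ->
  (forall w, r (nth s q h) w -> D w != 0) -> bfs_inv q h.+1 D.
Proof.
move=> [h1 h2 h3 h4 h5 h6 h7 h8 h9] hh hr; split=> //.
  move=> v hh1; apply: leq_trans (h5 v hh) _; rewrite ltnS.
  move/(pairwiseP 0): h4 => /(_ h h.+1); rewrite !inE !size_map => /(_ hh hh1 (ltnSn h)).
  by rewrite !(nth_map s).
move=> i w; rewrite ltnS leq_eqVlt => /orP[/eqP->|]; last exact: h6.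
by move=> /hr; rewrite -lt0n => ->; rewrite h5.
Qed.

(** Closedness, followed along a walk, bounds [D] from above by its length plus one; [bfs_walk]
    gives the converse. *)
Lemma bfs_inv_done q D : bfs_inv q (size q) D ->
  forall v, D v = if dist r s v is Some k then k.+1 else 0.
Proof.
move=> [h1 h2 h3 h4 h5 h6 h7 h8 h9].
have walk k v : has_walk r s v k -> 0 < D v <= k.+1.
  elim: k v => [|k IH] v; first by rewrite has_walk0 => /eqP<-; rewrite h8.
  rewrite -addn1 => /has_walk_split[u /IH/andP[hu hk]]; rewrite has_walk1 => hr.
  have uq : u \in q by rewrite h2 -lt0n.
  have hi : index u q < size q by rewrite index_mem.
  by have := h6 _ v hi; rewrite nth_index // => /(_ hr); lia.
move=> v; case E: (dist r s v) => [k|].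
  have /andP[] := walk _ _ (dist_walk E).
  case E': (D v) => [|j] // _ hj; have := dist_min E (h3 _ _ E'); lia.
case E': (D v) => [|j] //; have [k _] := dist_ex (h3 _ _ E'); by rewrite E.
Qed.

End BfsInvariant.

Lemma eq_bfs_inv (V : finType) (r : rel V) s q h D D' :
  D =1 D' -> bfs_inv r s q h D -> bfs_inv r s q h D'.
Proof. by move=> /funext->. Qed.

(* [Num] and [Sub] are shadowed by MathComp. *)
Notation Lit := Defs.Num.
Notation Minus := Defs.Sub.

Definition seqs (cs : seq cmd) : cmd := foldr Seq Skip cs.

(* Registers: 4 number of arcs, 6 source, 7-8 failed color (7 holds 0 if none),
   10 vertex being scanned, 11 list pointer, 12 arc, 13 its head, 14-15 ends of
   the queue, 16 loop counter.  Arrays: 9-10 adjacency lists (first arc of a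
   vertex, next arc; arc i is stored as i + 1), 11 distances + 1, 12 queue,
   13 last arcs. *)
Definition arc_alive : expr :=
  Lt (Add (Eq (Get 2 (Reg 12)) (Reg 8)) (Reg 7)) (Lit 2).

Definition incr (i : nat) : cmd := SetReg i (Add (Reg i) (Lit 1)).

Definition clear_loop : cmd :=
  While (Lt (Reg 16) (Reg 0))
    (seqs [:: SetArr 11 (Reg 16) (Lit 0); SetArr 13 (Reg 16) (Lit 0); incr 16]).

Definition scan_arc : cmd :=
  seqs [:: SetReg 12 (Minus (Reg 11) (Lit 1));
    SetReg 13 (Get 1 (Reg 12));
    If arc_alive
      (If (Get 11 (Reg 13)) Skip
        (seqs [:: SetArr 11 (Reg 13) (Add (Get 11 (Reg 10)) (Lit 1));
                  SetArr 12 (Reg 15) (Reg 13);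
                  incr 15]))
      Skip;
    SetReg 11 (Get 10 (Reg 12))].

Definition scan_vertex : cmd :=
  seqs [:: SetReg 10 (Get 12 (Reg 14)); SetReg 11 (Get 9 (Reg 10));
    While (Reg 11) scan_arc; incr 14].

Definition bfs_loop : cmd := While (Lt (Reg 14) (Reg 15)) scan_vertex.

Definition bfs_start : cmd :=
  seqs [:: SetArr 11 (Reg 6) (Lit 1); SetArr 12 (Lit 0) (Reg 6);
           SetReg 14 (Lit 0); SetReg 15 (Lit 1)].

Fixpoint chain (nx : nat -> nat) (p : nat) (l : seq nat) : Prop :=
  if l is i :: l' then p = i.+1 /\ chain nx (nx i) l' else p = 0.

(** * The search on linked adjacency lists *)

Section BfsProgram.
Variables (W n : nat) (arcs : seq ('I_n * 'I_n)) (col : 'I_n * 'I_n -> nat).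
Variable a0 : 'I_n * 'I_n.
Hypothesis W_large : n + size arcs + 4 <= W.

Notation arc := (nth a0 arcs).

(** Descending order, since arcs are inserted at the front of the lists; [k] counts the arcs
    inserted so far. *)
Definition out_arcs (k : nat) (v : 'I_n) : seq nat :=
  [seq i <- rev (iota 0 k) | (arc i).1 == v].

Definition arcs_loaded (st : state) : Prop :=
  [/\ reg st 0 = n, reg st 4 = size arcs &
    forall i, i < size arcs -> [/\ arr st 0 i = (arc i).1,
      arr st 1 i = (arc i).2 & arr st 2 i = col (arc i)]].

Definition lists_built (st : state) : Prop :=
  forall v : 'I_n, chain (arr st 10) (arr st 9 v) (out_arcs (size arcs) v).

Definition failed_loaded (o : option nat) (st : state) : Prop :=
  if o is Some c then reg st 7 = 1 /\ reg st 8 = c else reg st 7 = 0.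

Lemma mod_small k : k <= n + size arcs + 3 -> k %% W = k.
Proof. by move=> h; rewrite modn_small //; lia. Qed.

Lemma bool_mod (b : bool) : b %% W = b.
Proof. by rewrite mod_small //; case: b; lia. Qed.

(** The test adds the failure flag to the bit for equal colors; the sum is 2 exactly if the arc has
    failed. *)
Lemma eval_alive o st i : arcs_loaded st -> failed_loaded o st ->
  reg st 12 = i -> i < size arcs ->
  eval W st arc_alive = alive col o (arc i).
Proof.
move=> [_ _ hA] ho h12 hi; have [_ _ h2] := hA _ hi.
rewrite /arc_alive /= h12 h2 !bool_mod (mod_small (k := 2)) //; last by lia.
rewrite /alive; case: o ho => [c|] /=.
  move=> [-> ->]; rewrite mod_small; last by case: eqP; lia.
  rewrite (inj_eq Some_inj) eq_sym; by case: eqP.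
by move=> ->; rewrite mod_small; case: eqP; lia.
Qed.

Definition bfs_state o s (q : seq 'I_n) h (st : state) : Prop :=
  [/\ arcs_loaded st, lists_built st, failed_loaded o st,
      bfs_inv (avoid arcs col o) s q h (fun v : 'I_n => arr st 11 v) &
      [/\ forall i, i < size q -> arr st 12 i = nth s q i,
          reg st 14 = h & reg st 15 = size q]].

Lemma out_arcsP v i : (i \in out_arcs (size arcs) v) = (i < size arcs) && ((arc i).1 == v).
Proof. by rewrite mem_filter mem_rev mem_iota add0n andbC. Qed.

(** The state inside the scan of the h-th queue vertex: [l] are the arcs still to be examined, and
    [pre] records that pushing leaves the front of the queue alone. *)
Definition scanning o s h pre (l : seq nat) (st : state) : Prop :=
  exists q, [/\ bfs_state o s q h st, h < size q /\ take h.+1 q = pre, reg st 10 = nth s q h,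
    chain (arr st 10) (reg st 11) l &
    {subset l <= out_arcs (size arcs) (nth s q h)} /\
    forall i, i \in out_arcs (size arcs) (nth s q h) -> i \notin l ->
      alive col o (arc i) -> arr st 11 (arc i).2 != 0].

Lemma runs_scan_arc o s h pre i l st : scanning o s h pre (i :: l) st ->
  runs W scan_arc st (cost_bound scan_arc) (scanning o s h pre l).
Proof.
move=> [q [[hA hL hF hB [hq h14 h15]] [hh hpre] h10 [hp hc] [hsub hdone]]].
have hi : i \in out_arcs (size arcs) (nth s q h) by apply: hsub; rewrite mem_head.
have := hi; rewrite out_arcsP => /andP[hia /eqP hsrc].
have [hA0 hA4 hAA] := hA; have [a1 a2 a3] := hAA _ hia.
have sq : size q <= n by have := bfs_size hB; rewrite card_ord.
have one_mod : 1 %% W = 1 by apply: mod_small; lia.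
have W0 : 0 %% W = 0 by rewrite mod0n.
set u := nth s q h in h10 hi hsub hdone hsrc.
set w := (arc i).2 in a2.
have htest := @eval_alive o (set_reg (set_reg st 12 i) 13 w) i hA hF erefl hia.
apply: runs_loop_free => //.
move: htest; rewrite /= hp one_mod subn1 /= a2 => ->; rewrite eqb0 if_neg.
have hr : alive col o (arc i) -> avoid arcs col o u w.
  by move=> hal; rewrite /avoid -hsrc -surjective_pairing mem_nth.
have sub' : {subset l <= out_arcs (size arcs) u}.
  by move=> j hj; apply: hsub; rewrite in_cons hj orbT.
case: ifP => hal; last first.
  exists q; split=> //; split=> // j hj hjl hja; apply: hdone => //.
  by rewrite in_cons negb_or hjl andbT; apply: contraFN hal => /eqP<-.
case: eqP => hw; last first.
  exists q; split=> //; split=> // j hj hjl hja.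
  have [E|ne] := eqVneq j i; first by rewrite E; apply/eqP.
  by apply: hdone => //; rewrite in_cons negb_or ne.
(* Distances are bounded by the queue length, hence by n, so adding 1 does not wrap around. *)
have hD := bfs_small hB u; rewrite /= in hD.
have hB' := bfs_inv_push hB hh (hr hal) hw.
rewrite h10 h15 !mod_small ?addn1; try by rewrite /=; lia.
exists (rcons q w); have hnth : nth s (rcons q w) h = u by rewrite nth_rcons hh.
rewrite size_rcons hnth; split=> //; last 2 first.
- by split; [lia | rewrite -cats1 takel_cat].
- split=> // j hj hjl hja /=; case: ifP => // /negbT hne; apply: hdone => //.
  by rewrite in_cons negb_or hjl andbT; apply: contra hne => /eqP->.
split=> //; split=> //= [j|]; last by rewrite size_rcons.
rewrite size_rcons ltnS leq_eqVlt nth_rcons => /orP[/eqP->|hj].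
  by rewrite eqxx ltnn.
by rewrite hj ltn_eqF // hq.
Qed.

Definition adj_cost : nat := cost_bound scan_arc + 2.

Lemma runs_scan_list o s h pre l st : scanning o s h pre l st ->
  runs W (While (Reg 11) scan_arc) st (adj_cost * size l + 2) (scanning o s h pre [::]).
Proof.
move=> hl0.
apply: (@runs_while _ _ _ (fun phi st => exists l,
  scanning o s h pre l st /\ phi = adj_cost * size l + 2)); last by exists l.
  move=> _ st' [l' [hl ->]] E; case: l' hl => [|i l'] hl.
    by case: hl => [q [_ _ _ /= E' _]]; rewrite /= E' in E.
  exists (cost_bound scan_arc), (adj_cost * size l' + 2); split.
    have -> : adj_cost * size (i :: l') = cost_bound scan_arc + 2 + adj_cost * size l'.
      by rewrite [size _]/= mulnS.
    by change (ecost (Reg 11)) with 1; lia.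
  by apply: runs_weaken (runs_scan_arc hl) _ _ => // st'' h'; exists l'.
move=> _ st' [l' [hl ->]] E; case: l' hl => [|i l'] hl; first by split=> //; rewrite muln0.
by case: hl => [q [_ _ _ [E' _] _]]; rewrite /= E' in E.
Qed.

Lemma runs_scan_vertex o s q h st : bfs_state o s q h st -> h < size q ->
  runs W scan_vertex st (adj_cost * size (out_arcs (size arcs) (nth s q h)) + 20)
    (fun st' => exists2 q', bfs_state o s q' h.+1 st' & take h.+1 q' = take h.+1 q).
Proof.
move=> [hA hL hF hB [hq h14 h15]] hh.
apply: runs_le.
  apply: runs_free_seq => //; apply: runs_free_seq => //.
  rewrite /= h14 hq //.
  set u := nth s q h.
  apply: runs_seq.
    apply: (@runs_scan_list o s h (take h.+1 q) (out_arcs (size arcs) u)).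
    by exists q; split=> //; [apply: hL | split=> // i ->].
  move=> st3 hs; apply: (@runs_loop_free W (seqs [:: incr 14]) st3) => //.
  move: hs => [q' [[hA' hL' hF' hB' [hq' h14' h15']] [hh' hpre] _ _ [_ hdone]]].
  have sq : size q' <= n by have := bfs_size hB'; rewrite card_ord.
  have one_mod : 1 %% W = 1 by apply: mod_small; lia.
  exists q'; last by rewrite hpre.
  rewrite /= h14' one_mod mod_small ?addn1; last by lia.
  split=> //.
  apply: bfs_inv_next hB' hh' _ => w /andP[hw hal].
  have hi : index (nth s q' h, w) arcs < size arcs by rewrite index_mem.
  have := hdone (index (nth s q' h, w) arcs); rewrite out_arcsP hi nth_index //=.
  by rewrite eqxx; apply.
by rewrite /=; lia.
Qed.

Lemma sum_out_arcs k : \sum_(v < n) size (out_arcs k v) = k.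
Proof.
rewrite -[RHS](size_iota 0) -size_rev /out_arcs.
elim: (rev _) => [|i l IH] /=; first by rewrite big1.
rewrite -IH (bigD1 (arc i).1) //= eqxx /= addSn [in RHS](bigD1 (arc i).1) //=.
by congr (_ + _).+1; apply: eq_bigr => v; rewrite eq_sym => /negbTE->.
Qed.

(** The potential sums over the vertices not yet scanned; the queue has no repetition, so each scan
    removes its own summand. The 24 is the 20 of the scan plus 4 for the loop test. *)
Lemma runs_bfs_loop o s st : bfs_state o s [:: s] 0 st ->
  runs W bfs_loop st (\sum_(v < n) (adj_cost * size (out_arcs (size arcs) v) + 24) + 4)
    (fun st' => exists q, bfs_state o s q (size q) st').
Proof.
move=> h0; pose f v := adj_cost * size (out_arcs (size arcs) v) + 24.
apply: (@runs_while _ _ _ (fun phi st => exists q h,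
  bfs_state o s q h st /\ phi = \sum_(v | v \notin take h q) f v + 4)); last first.
- exists [:: s], 0; split=> //; congr (_ + _); rewrite /f; apply: eq_bigl => v.
- move=> _ st' [q [h [hb ->]]] /= E; split; first by lia.
  have [_ _ _ hB [_ h14 h15]] := hb.
  exists q; move: E; rewrite h14 h15 bool_mod => /eqP; rewrite eqb0 -leqNgt => hq.
  by have -> : size q = h by apply/eqP; rewrite eqn_leq hq (bfs_head hB).
move=> _ st' [q [h [hb ->]]] /= E.
have [_ _ _ hB [_ h14 h15]] := hb.
have hh : h < size q by move: E; rewrite h14 h15 bool_mod eqb0 negbK.
exists (adj_cost * size (out_arcs (size arcs) (nth s q h)) + 20).
exists (\sum_(v | v \notin take h.+1 q) f v + 4); split; last first.
  apply: runs_weaken (runs_scan_vertex hb hh) _ _ => // st'' [q' h1 h2].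
  by exists q', h.+1; rewrite h2.
have hnin : nth s q h \notin take h q.
  have := bfs_uniq hB; rewrite -{1}(cat_take_drop h q) cat_uniq => /and3P[_ /hasPn hn _].
  by apply: hn; rewrite (drop_nth s hh) mem_head.
have -> : \sum_(v | v \notin take h q) f v =
    f (nth s q h) + \sum_(v | v \notin take h.+1 q) f v.
  rewrite (bigD1 (nth s q h)) //=; congr (_ + _); apply: eq_bigl => v.
  by rewrite (take_nth s hh) mem_rcons inE negb_or andbC.
change (ecost (Lt (Reg 14) (Reg 15))) with 3.
by move: (\sum_(v | _) _) => x; rewrite /f; lia.
Qed.
End BfsProgram.

(** * Selecting the last arcs *)

Definition mark_arc : cmd :=
  If (Lt (Reg 12) (Reg 1)) (SetArr 4 (Reg 12) (Lit 1))
     (SetArr 4 (Minus (Reg 12) (Reg 1)) (Lit 1)).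

Definition try_arc : cmd :=
  Seq (If arc_alive
        (If (Get 11 (Get 0 (Reg 12)))
          (If (Eq (Get 11 (Get 1 (Reg 12))) (Add (Get 11 (Get 0 (Reg 12))) (Lit 1)))
            (If (Get 13 (Get 1 (Reg 12))) Skip
               (Seq (SetArr 13 (Get 1 (Reg 12)) (Add (Reg 12) (Lit 1))) mark_arc))
            Skip)
          Skip)
        Skip)
      (incr 12).

Definition mark_loop : cmd := While (Lt (Reg 12) (Reg 4)) try_arc.

Definition search : cmd :=
  seqs [:: SetReg 16 (Lit 0); clear_loop; bfs_start; bfs_loop;
           SetReg 12 (Lit 0); mark_loop].

Section SearchProgram.
Variables (W n m : nat) (arcs : seq ('I_n * 'I_n)) (col : 'I_n * 'I_n -> nat).
Variable a0 : 'I_n * 'I_n.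
Hypothesis W_large : n + size arcs + 4 <= W.

Notation arc := (nth a0 arcs).

(* Arcs [i] and [m + i] are the two directions of the undirected edge [i]. *)
Definition edge_pos (i : nat) : nat := if i < m then i else i - m.

(** The position of the last arc chosen for [v]; it is [size arcs] if there is none. *)
Definition pos (o : option nat) (s v : 'I_n) : nat :=
  find (fun a => (a.2 == v) && tight arcs col o s a) arcs.

Lemma last_arc_pos o s v : last_arc arcs col o s v =
  if pos o s v < size arcs then Some (arc (pos o s v)) else None.
Proof.
rewrite /last_arc /pos; move: (fun a => _) => p.
by elim: arcs => //= b l IH; case: (p b).
Qed.

Lemma pos_eq o s v k : k < size arcs ->
  (pos o s v == k) =
  [&& (arc k).2 == v, tight arcs col o s (arc k) & k <= pos o s v].
Proof.
move=> hk; apply/eqP/and3P => [E|[h1 h2 h3]].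
  have h : has (fun a => (a.2 == v) && tight arcs col o s a) arcs by rewrite has_find -/(pos o s v) E.
  by have := nth_find a0 h; rewrite -/(pos o s v) E => /andP[-> ->].
apply/eqP; rewrite eqn_leq h3 andbT leqNgt; apply/negP => hlt.
by have := before_find a0 hlt; rewrite /= h1 h2.
Qed.

Definition loaded o (s : 'I_n) st : Prop :=
  [/\ arcs_loaded arcs col a0 st, lists_built arcs a0 st, failed_loaded o st,
    reg st 6 = s & reg st 1 = m].

(** The state after the first [k] arcs. Marks accumulate over all searches: [out0] is the marking
    found at the start of this one. *)
Definition searched o s (k : nat) (out0 : nat -> nat) st : Prop :=
  (forall v : 'I_n, arr st 13 v = if pos o s v < k then (pos o s v).+1 else 0) /\
  (forall i, arr st 4 i != 0 <->
     out0 i != 0 \/ exists2 v, pos o s v < k & edge_pos (pos o s v) = i).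

Lemma one_mod : 1 %% W = 1. Proof. by apply: (@mod_small W n arcs) => //; lia. Qed.

Definition cleared o (s : 'I_n) out0 k st : Prop :=
  [/\ loaded o s st, reg st 16 = k, forall i, arr st 4 i = out0 i &
     forall v, v < k -> arr st 11 v = 0 /\ arr st 13 v = 0].

Lemma runs_clear_loop o s out0 st : cleared o s out0 0 st ->
  runs W clear_loop st (n * 15 + 4) (cleared o s out0 n).
Proof.
move=> h0; apply: runs_le.
  apply: (@runs_for _ _ _ (cleared o s out0) n (fun=> 11)) => //; last first.
    move=> st' [[[h _ _] _ _ _ _] h' _ _].
    by rewrite /= h h' ltnn (bool_mod W_large).
  move=> k st' hk [[hA hL hF h6 h1] h16 h4 hv]; have [hA0 hA4 hAA] := hA.
  rewrite /= hA0 h16 hk (bool_mod W_large); split=> //.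
  apply: runs_le; first apply: runs_loop_free => //; last by [].
  rewrite /= h16 one_mod mod0n (@mod_small W n arcs) ?addn1 //; last by lia.
  split=> //= v; rewrite ltnS leq_eqVlt => /orP[/eqP->|hlt]; first by rewrite eqxx.
  by rewrite ltn_eqF //; apply: hv.
by rewrite sum_nat_const card_ord /=; lia.
Qed.

Definition marking o s out0 k st : Prop :=
  [/\ loaded o s st, reg st 12 = k, searched o s k out0 st &
     forall v : 'I_n, arr st 11 v <= n /\
       arr st 11 v = if dist (avoid arcs col o) s v is Some d then d.+1 else 0].

Lemma runs_try_arc o s out0 k st : k < size arcs -> marking o s out0 k st ->
  runs W try_arc st (cost_bound try_arc) (marking o s out0 k.+1).
Proof.
move=> hk [[hA hL hF h6 h1] h12 [hpar hout] hD].
have [hA0 hA4 hAA] := hA; have [a1 a2 a3] := hAA _ hk.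
have htest := @eval_alive W n arcs col a0 W_large o st k hA hF h12 hk.
set u := (arc k).1 in a1; set w := (arc k).2 in a2.
have [hu hu'] := hD u; have [hw hw'] := hD w.
(* With distances stored plus one, a nonzero entry means reachable, and the shift cancels in the
   comparison. *)
have tightE : tight arcs col o s (arc k) = [&& alive col o (arc k),
    arr st 11 u != 0 & arr st 11 w == arr st 11 u + 1].
  rewrite /tight -/u -/w hu' hw'; congr andb.
  case: (dist _ s u) => //= d; case: (dist _ s w) => [e|]; last by rewrite addn1.
  by rewrite (inj_eq Some_inj) addn1 eqSS.
(* If arc [k] is not the first choice for its head, no position equals [k] and the invariant moves
   on with the memory unchanged. *)
have stay : ~~ [&& tight arcs col o s (arc k) & k <= pos o s w] ->
    searched o s k.+1 out0 st.
  move=> hno; have hne v : (pos o s v < k.+1) = (pos o s v < k).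
    rewrite ltnS leq_eqVlt pos_eq //; case: eqP => //= <-.
    by rewrite (negbTE hno).
  split=> [v|i]; first by rewrite hne.
  by rewrite hout; split=> -[h|[v h h']]; [left|right|left|right] => //; exists v => //;
     rewrite ?hne // -hne.
apply: runs_loop_free => //.
move: htest; rewrite /= h12 a1 a2 one_mod !(bool_mod W_large) => htest; rewrite htest eqb0.
have k1 : (k + 1) %% W = k.+1 by rewrite (@mod_small W n arcs) ?addn1 //; lia.
rewrite (@mod_small W n arcs _ (arr st 11 u + 1)) //; last by lia.
case: ifP => hal.
  rewrite /= h12 k1; split=> //; apply: stay; rewrite tightE; by rewrite (negbTE hal).
move/negbFE: hal => hal.
case: ifP => hu0.
  by rewrite /= h12 k1; split=> //; apply: stay; rewrite tightE hu0 andbF.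
rewrite eqb0; case: ifP => hw0.
  by rewrite /= h12 k1; split=> //; apply: stay; rewrite tightE (negbTE hw0) !andbF.
move/negbFE: hw0 => hw0.
have ht : tight arcs col o s (arc k) by rewrite tightE hal hu0 hw0.
rewrite hpar; case: ifP => hp; last first.
  have {}hp : pos o s w < k by move: hp; case: ifP.
  by rewrite /= h12 k1; split=> //; apply: stay; rewrite ht /= leqNgt hp.
have {}hp : k <= pos o s w by rewrite leqNgt; apply/negP => h; rewrite h in hp.
have hk' v : (pos o s v < k.+1) = (v == w) || (pos o s v < k).
  rewrite ltnS leq_eqVlt pos_eq // ht /= eq_sym; case: eqP => // ->; by rewrite hp.
have hpw : pos o s w = k by apply/eqP; rewrite pos_eq // eqxx ht.
have mark st' : reg st' 12 = k.+1 -> loaded o s st' ->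
    (forall v : 'I_n, arr st' 11 v = arr st 11 v) ->
    (forall v : 'I_n, arr st' 13 v = if v == w then k.+1 else arr st 13 v) ->
    (forall i, arr st' 4 i = if i == edge_pos k then 1 else arr st 4 i) ->
    marking o s out0 k.+1 st'.
  move=> e1 e2 e3 e4 e5; split=> //; last by move=> v; rewrite e3.
  split=> [v|i].
    rewrite e4 hk'; case: eqP => [->|_]; first by rewrite hpw.
    by rewrite hpar.
  rewrite e5; case: (i =P edge_pos k) => [->|ne]; split=> //.
  - by move=> _; right; exists w; rewrite ?hk' ?eqxx // hpw.
  - move=> /hout[h|[v h h']]; [by left|right; exists v => //].
    by rewrite hk' h orbT.
  case=> [h|[v h h']]; apply/hout; first by left.
  move: h; rewrite hk' => /orP[/eqP E|h]; last by right; exists v.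
  by case: ne; rewrite -h' E hpw.
rewrite h1 eqb0; case: ifP => hkm.
  rewrite /= h12 k1; apply: mark => //= i.
  by rewrite /edge_pos (negbTE hkm).
rewrite /= h12 k1; apply: mark => //= i.
by rewrite /edge_pos (negbFE hkm).
Qed.

Lemma runs_mark_loop o s out0 st : marking o s out0 0 st ->
  runs W mark_loop st (size arcs * (cost_bound try_arc + 4) + 4)
    (searched o s (size arcs) out0).
Proof.
move=> h0; apply: runs_weaken.
- apply: (@runs_for _ _ _ (marking o s out0) (size arcs) (fun=> cost_bound try_arc)) => //.
    move=> k st' hk h; split; last exact: runs_try_arc.
    by case: h => [[[_ h _] _ _ _ _] h' _ _]; rewrite /= h h' hk (bool_mod W_large).
  move=> st' [[[_ h _] _ _ _ _] h' _ _].
  by rewrite /= h h' ltnn (bool_mod W_large).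
- by rewrite sum_nat_const card_ord.
by move=> st' [].
Qed.

Definition search_cost : nat := 200.

Lemma runs_search o (s : 'I_n) st : loaded o s st ->
  runs W search st (search_cost * (n + size arcs + 1))
    (searched o s (size arcs) (arr st 4)).
Proof.
move=> hl; have [hA hL hF h6 h1] := hl.
apply: runs_le.
  apply: runs_free_seq => //; apply: runs_seq.
    by apply: (@runs_clear_loop o s (arr st 4)); rewrite /= mod0n; split.
  move=> st1 [[hA1 hL1 hF1 h61 h11] h16 h4 hv].
  apply: runs_free_seq => //; apply: runs_seq.
    apply: (runs_frame (@runs_bfs_loop W n arcs col a0 W_large o s _ _)).
    rewrite /= mod0n one_mod h61; split=> //; last by split=> // -[].
    apply: eq_bfs_inv (bfs_inv_init _ s) => v /=; rewrite (inj_eq val_inj).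
    by case: eqP => // _; case: (hv v (ltn_ord v)).
  move=> st2 [[q [hA2 hL2 hF2 hB [hq h14 h15]]] [fr fa]].
  apply: runs_free_seq => //; apply: runs_seq; last first.
    by move=> st3 h3; apply: (@runs_loop_free W Skip st3) => //; exact: h3.
  apply: runs_mark_loop; rewrite /= mod0n; split=> //.
  - by split=> //=; rewrite fr.
  - split=> [v|i] /=; rewrite fa //=.
      by case: (hv v (ltn_ord v)).
    by rewrite h4; split=> [|[//|[]]] //; left.
  move=> v; split; first by have := bfs_small hB v; have := bfs_size hB; rewrite card_ord /=; lia.
  exact: bfs_inv_done hB v.
rewrite /search_cost /=; rewrite big_split /= -big_distrr /= (sum_out_arcs arcs a0) sum_nat_const card_ord.
rewrite /adj_cost /=; lia.
Qed.

End SearchProgram.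

(** * All failures for all sources *)

(* Register 5 counts sources, 17 vertices; array 14 keeps the last arcs of the
   failure-free search, whose colors are the failures to be tried. *)
Definition save_loop : cmd :=
  While (Lt (Reg 17) (Reg 0))
    (Seq (SetArr 14 (Reg 17) (Get 13 (Reg 17))) (incr 17)).

Definition try_color : cmd :=
  Seq (If (Get 14 (Reg 17))
         (Seq (SetReg 8 (Get 2 (Minus (Get 14 (Reg 17)) (Lit 1)))) search) Skip)
      (incr 17).

Definition color_loop : cmd := While (Lt (Reg 17) (Reg 0)) try_color.

Definition process_source : cmd :=
  seqs [:: SetReg 6 (Get 3 (Reg 5)); SetReg 7 (Lit 0); search;
    SetReg 17 (Lit 0); save_loop; SetReg 7 (Lit 1); SetReg 17 (Lit 0);
    color_loop; incr 5].

Definition source_loop : cmd := While (Lt (Reg 5) (Reg 2)) process_source.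

Section SourceProgram.
Variables (W n m : nat) (arcs : seq ('I_n * 'I_n)) (col : 'I_n * 'I_n -> nat).
Variable a0 : 'I_n * 'I_n.
Hypothesis W_large : n + size arcs + 4 <= W.
Hypotheses (n_gt0 : 0 < n) (m_gt0 : 0 < m) (arcs_le : size arcs <= 2 * m).

Notation arc := (nth a0 arcs).
Notation pos := (pos arcs col).
Notation one_mod := (one_mod W_large).

Definition marked o (s : 'I_n) (i : nat) : Prop :=
  exists2 v, pos o s v < size arcs & edge_pos m (pos o s v) = i.

(** Meaningful only if a tree arc enters [v]; otherwise it is the color of the default arc. *)
Definition tree_color (s v : 'I_n) : nat := col (arc (pos None s v)).

Definition marked_upto (s : 'I_n) (k i : nat) : Prop :=
  exists v : 'I_n, [/\ v < k, pos None s v < size arcs & marked (Some (tree_color s v)) s i].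

(** Last arcs into different vertices have different heads. This bounds the number of searches by
    the arcs, which matters when m is smaller than n. *)
Lemma card_tree o (s : 'I_n) : #|[set v | pos o s v < size arcs]| <= size arcs.
Proof.
rewrite -(@card_in_imset _ _ (fun v => arc (pos o s v))); last first.
  move=> v w; rewrite !inE => hv hw E.
  have := @pos_eq n arcs col a0 o s v _ hv; rewrite eqxx => /esym/and3P[/eqP<- _ _].
  have := @pos_eq n arcs col a0 o s w _ hw; rewrite eqxx => /esym/and3P[/eqP<- _ _].
  by rewrite E.
apply: leq_trans (card_size arcs); apply/subset_leq_card/subsetP => _ /imsetP[v hv ->].
by rewrite mem_nth //; move: hv; rewrite inE.
Qed.

Definition base st : Prop :=
  [/\ arcs_loaded arcs col a0 st, lists_built arcs a0 st & reg st 1 = m].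

Lemma runs_save_loop st : reg st 0 = n -> reg st 17 = 0 ->
  runs W save_loop st (n * 12 + 4) (fun st' => forall v, v < n -> arr st' 14 v = arr st 13 v).
Proof.
move=> h0 h17; apply: runs_weaken.
- apply: (@runs_for _ _ _ (fun k st' => [/\ reg st' 0 = n, reg st' 17 = k,
    forall v, arr st' 13 v = arr st 13 v &
    forall v, v < k -> arr st' 14 v = arr st 13 v]) n (fun=> 8)) => //; last first.
    by move=> st' [h h' _ _]; rewrite /= h h' ltnn (bool_mod W_large).
  move=> k st' hk [e1 e2 e3 e4]; rewrite /= e1 e2 hk (bool_mod W_large); split=> //.
  apply: runs_le; first apply: runs_loop_free => //; last by [].
  rewrite /= e2 one_mod (@mod_small W n arcs) ?addn1 //; last by lia.
  split=> //= v; rewrite ltnS leq_eqVlt => /orP[/eqP->|hlt]; first by rewrite eqxx e3.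
  by rewrite ltn_eqF //; apply: e4.
- by rewrite sum_nat_const card_ord /=; lia.
by move=> st' [].
Qed.

Definition run_cost : nat := search_cost * (n + size arcs + 1).

Definition trying (s : 'I_n) (out0 : nat -> nat) k st : Prop :=
  [/\ base st, reg st 6 = s /\ reg st 7 = 1, reg st 17 = k,
    forall v : 'I_n, arr st 14 v = if pos None s v < size arcs then (pos None s v).+1 else 0 &
    forall i, arr st 4 i != 0 <-> out0 i != 0 \/ marked_upto s k i].

Lemma runs_color_loop s out0 st : trying s out0 0 st ->
  runs W color_loop st 
    (n * 30 + #|[set v | pos None s v < size arcs]| * run_cost + 4) (trying s out0 n).
Proof.
(* A round is charged a search only if its vertex has a tree arc; [insub] turns the counter into a
   vertex. *)
move=> h0; pose b k := 20 + (if insub k is Some v then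
   if pos None s v < size arcs then run_cost else 0 else 0).
apply: runs_le.
  apply: (@runs_for _ _ _ (trying s out0) n b) => //; last first.
    move=> st' [[[h _ _] _ _] _ h' _ _].
    by rewrite /= h h' ltnn (bool_mod W_large).
  move=> k st' hk [hb h67 h17 h14 hout].
  have [hA hL h1] := hb; have [hA0 hA4 hAA] := hA; have [h6 h7] := h67.
  split; first by rewrite /= hA0 h17 hk (bool_mod W_large).
  pose v := Ordinal hk; have h14v := h14 v.
  have kW : (k + 1) %% W = k.+1 by rewrite (@mod_small W n arcs) ?addn1 //; lia.
  rewrite /b insubT /=.
  case: ifP => hp.
    rewrite hp in h14v.
    apply: runs_le.
      apply: runs_seq; last by move=> st1 h; apply: (@runs_loop_free W (incr 17) st1) => //; apply: h.
      apply: runs_if => /=; rewrite h17 h14v // => _.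
      apply: runs_free_seq => //.
      rewrite /= h17 h14v one_mod subn1 /=.
      apply: (runs_weaken (runs_frame (@runs_search W n m arcs col a0 W_large (Some (tree_color s v)) s _ _)) (leqnn _)).
        split=> //; split=> //=; rewrite /tree_color.
        by have [_ _ ->] := hAA _ hp.
      move=> st1 [[hpar hout1] [fr fa]] /=; rewrite fr //= h17. rewrite kW.
      split=> //=.
      - split=> //=; last by rewrite fr.
        + split; rewrite /= ?fr // => i hi; rewrite !fa //=; exact: hAA.
        move=> u /=; rewrite fa //=; have := hL u.
        have -> : arr st1 10 = arr st' 10 by apply/funext => j; rewrite fa.
        by [].
      - by rewrite !fr.
      - by move=> u; rewrite fa //= h14.
      move=> i; rewrite hout1 /= hout; split.
        case=> [[h|[u [e1 e2 e3]]]|h]; first by left.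
          by right; exists u; split=> //; apply: leqW.
        by right; exists v.
      case=> [h|[u [e1 e2 e3]]]; first by left; left.
      move: e1; rewrite ltnS leq_eqVlt => /orP[/eqP E|h]; last by left; right; exists u.
      by right; have <- : u = v by apply: val_inj.
    by rewrite /= /run_cost; lia.
  rewrite hp in h14v; apply: runs_le.
    apply: runs_seq; last by move=> st1 h; apply: (@runs_loop_free W (incr 17) st1) => //; apply: h.
    apply: runs_if => /=; rewrite h17 h14v // => _.
    apply: (@runs_loop_free W Skip st') => //; rewrite /= h17 one_mod kW.
    split=> //= i; rewrite hout; split=> -[h|[u [e1 e2 e3]]]; try by left.
      by right; exists u; split=> //; apply: leqW.
    right; exists u; split=> //; move: e1; rewrite ltnS leq_eqVlt => /orP[/eqP E|//].
    have hp' : (pos None s v < size arcs) = false := hp.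
    have E' : u = v by apply: val_inj.
    by move: e2; rewrite E' hp'.
  by [].
rewrite big_split /= sum_nat_const card_ord /b big_split /= sum_nat_const card_ord.
rewrite (eq_bigr (fun v : 'I_n => if pos None s v < size arcs then run_cost else 0)); last first.
  by move=> v _; rewrite valK.
rewrite -big_mkcond /= sum_nat_const cardsE; lia.
Qed.

Definition relevant (s : 'I_n) (o : option nat) : Prop :=
  o = None \/ exists2 v, pos None s v < size arcs & o = Some (tree_color s v).

Definition marked_source (s : 'I_n) (i : nat) : Prop :=
  exists2 o, relevant s o & marked o s i.

Variables (s0 : 'I_n) (ss : seq 'I_n).

Definition sources_done (k : nat) st : Prop :=
  [/\ base st, reg st 2 = size ss, forall j, j < size ss -> arr st 3 j = nth s0 ss j,
    reg st 5 = k &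
    forall i, arr st 4 i != 0 <->
      exists2 j, j < k & marked_source (nth s0 ss j) i].

Definition source_cost : nat := 5000 * (n * m).

Lemma base_frame c st st' : same_outside c st st' -> base st ->
  all (fun i => i \notin written_regs c) [:: 0; 1; 4] ->
  all (fun a => a \notin written_arrs c) [:: 0; 1; 2; 9; 10] -> base st'.
Proof.
move=> [fr fa] [[h0 h4 hA] hL h1] /and4P[r0 r1 r4 _] /and5P[a_0 a_1 a_2 a_9 /andP[a_10 _]].
split=> //; rewrite ?fr //.
  by split; rewrite ?fr // => i hi; rewrite !fa //; exact: hA.
move=> v; rewrite fa //; have -> : arr st' 10 = arr st 10 by apply/funext => j; rewrite fa.
exact: hL.
Qed.

Lemma runs_process_source k st : k < size ss -> size ss <= n -> sources_done k st ->
  runs W process_source st source_cost (sources_done k.+1).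
Proof.
move=> hk hss [hb h2 h3 h5 hout]; set s := nth s0 ss k.
have [hA hL h1] := hb.
have kW : (k + 1) %% W = k.+1 by rewrite (@mod_small W n arcs) ?addn1 //; lia.
apply: runs_le.
  apply: runs_free_seq => //; apply: runs_free_seq => //; apply: runs_seq.
    apply: (runs_frame (@runs_search W n m arcs col a0 W_large None s _ _)).
    by rewrite /= mod0n h5 h3 //; split.
  move=> st1 [[hpar hout1] fr1].
  have hb1 : base st1 by apply: (base_frame fr1).
  have [fr fa] := fr1.
  have r5 : reg st1 5 = k by rewrite fr.
  have r6 : reg st1 6 = s by rewrite fr //= h5 h3.
  have r2 : reg st1 2 = size ss by rewrite fr.
  have a3 j : j < size ss -> arr st1 3 j = nth s0 ss j by move=> hj; rewrite fa //= h3.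
  move: hb1 r5 r6 r2 a3 {fr fa fr1} => hb1 r5 r6 r2 a3.
  apply: runs_free_seq => //; apply: runs_seq.
    apply: (runs_frame (@runs_save_loop _ _ _)); rewrite /= ?mod0n //.
    by case: hb1 => [[]].
  move=> st2 [h14 fr2]; have [fr fa] := fr2.
  have hb2 : base st2 by apply: (base_frame fr2).
  have r5' : reg st2 5 = k by rewrite fr.
  have r6' : reg st2 6 = s by rewrite fr.
  have r2' : reg st2 2 = size ss by rewrite fr.
  have a3' j : j < size ss -> arr st2 3 j = nth s0 ss j by move=> hj; rewrite fa //= a3.
  have a4' i : arr st2 4 i = arr st1 4 i by rewrite fa.
  move: hb2 r5' r6' r2' a3' {fr fa fr2} => hb2 r5' r6' r2' a3'.
  apply: runs_free_seq => //; apply: runs_free_seq => //; apply: runs_seq.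
    apply: (runs_frame (@runs_color_loop s (arr st1 4) _ _)).
    rewrite /= one_mod mod0n; split=> //= [v|i]; first by rewrite h14 //= hpar.
    by rewrite a4'; split=> [|[|[u []]] //]; left.
  move=> st3 [[hb3 _ _ _ hout3] [fr fa]].
  apply: (@runs_loop_free W (seqs [:: incr 5]) st3) => //.
  rewrite /= fr //= r5' one_mod kW; split=> //=; rewrite ?fr //.
    by move=> j hj; rewrite fa //= a3'.
  move=> i; rewrite hout3 hout1 /= hout; split.
    case=> [[[j hj hm]|hm]|[u [_ hu hm]]]; first by exists j => //; apply: leqW.
      by exists k => //; exists None => //; left.
    by exists k => //; exists (Some (tree_color s u)) => //; right; exists u.
  case=> j; rewrite ltnS leq_eqVlt => /orP[/eqP->|hj] hm; last by left; left; exists j.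
  case: hm => o [->|[u hu ->]] hm; first by left; right.
  by right; exists u; split.
have t1 := card_tree None s; have t2 := max_card [set v | pos None s v < size arcs].
rewrite card_ord in t2; move: (#|[set v | _]|) t1 t2 => t t1 t2.
have e1 : run_cost <= 800 * (n * m) by rewrite /run_cost /search_cost; nia.
(* Both bounds on the number [t] of tree arcs are used: t <= 2m against the summand n, and t <= n
   against the rest. *)
have e2 : t * (n + size arcs + 1) <= 5 * (n * m).
  have : t * n <= 2 * m * n by rewrite leq_mul2r; apply/orP; right; lia.
  have : t * (size arcs + 1) <= n * (3 * m) by apply: leq_mul; lia.
  by rewrite -addnA mulnDr; lia.
have e3 : t * run_cost <= 1000 * (n * m) by rewrite /run_cost /search_cost; lia.
have e4 : n <= n * m by rewrite leq_pmulr.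
have e5 : 1 <= n * m by rewrite muln_gt0 n_gt0.
rewrite /run_cost in e1 e3; rewrite /source_cost /run_cost /=; lia.
Qed.

Lemma runs_source_loop st : size ss <= n -> sources_done 0 st ->
  runs W source_loop st (size ss * (source_cost + 4) + 4) (sources_done (size ss)).
Proof.
move=> hss h0; apply: runs_le.
  apply: (@runs_for _ _ _ sources_done (size ss) (fun=> source_cost)) => //.
    move=> k st' hk h; split; last exact: runs_process_source.
    by case: h => [_ h2 _ h5 _]; rewrite /= h2 h5 hk (bool_mod W_large).
  by move=> st' [_ h2 _ h5 _]; rewrite /= h2 h5 ltnn (bool_mod W_large).
by rewrite sum_nat_const card_ord.
Qed.

End SourceProgram.

(** * The program *)

Definition reverse_loop : cmd :=
  While (Lt (Reg 16) (Reg 1))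
    (seqs [:: SetArr 0 (Add (Reg 1) (Reg 16)) (Get 1 (Reg 16));
              SetArr 1 (Add (Reg 1) (Reg 16)) (Get 0 (Reg 16));
              SetArr 2 (Add (Reg 1) (Reg 16)) (Get 2 (Reg 16));
              incr 16]).

Definition build_arcs : cmd :=
  If (Reg 3) (SetReg 4 (Reg 1))
    (seqs [:: SetReg 16 (Lit 0); reverse_loop; SetReg 4 (Add (Reg 1) (Reg 1))]).

Definition list_loop : cmd :=
  While (Lt (Reg 12) (Reg 4))
    (seqs [:: SetArr 10 (Reg 12) (Get 9 (Get 0 (Reg 12)));
              SetArr 9 (Get 0 (Reg 12)) (Add (Reg 12) (Lit 1));
              incr 12]).

Definition main_program : cmd :=
  If (Reg 1)
    (If (Reg 2)
      (seqs [:: build_arcs; SetReg 12 (Lit 0); list_loop; SetReg 5 (Lit 0); source_loop])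
      Skip)
    Skip.

(** A list reads only the next pointers of its own entries, so setting that of a new arc leaves the
    older lists intact. *)
Lemma chain_eq nx nx' p l : {in l, nx =1 nx'} -> chain nx p l -> chain nx' p l.
Proof.
elim: l p => //= i l IH p h [h1 h2]; split=> //.
rewrite -h ?mem_head //; apply: IH h2 => j hj; apply: h.
by rewrite in_cons hj orbT.
Qed.

Section MainProgram.
Variables (W n : nat) (G : cgraph n) (es : seq ('I_n * 'I_n)).
Variables (a0 : 'I_n * 'I_n) (s0 : 'I_n) (ss : seq 'I_n).
Hypothesis es_edges : es =i edges G.
Hypothesis es_uniq : uniq es.

Notation m := (size es).
Notation arcs := (graph_arcs G es).
Notation col := (arc_color G).
Notation arc := (nth a0 arcs).

Hypothesis W_large : n + 2 * m + 4 <= W.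
Hypotheses (n_gt0 : 0 < n) (m_gt0 : 0 < m).

Lemma size_graph_arcs : size arcs = if directed G then m else m + m.
Proof. by rewrite size_cat; case: directed; rewrite ?addn0 // size_map. Qed.

Lemma size_arcs_le : size arcs <= 2 * m.
Proof. by rewrite size_graph_arcs; case: directed; lia. Qed.

Lemma W_large' : n + size arcs + 4 <= W.
Proof. by have := size_arcs_le; lia. Qed.

Lemma edge_pos_lt p : p < size arcs -> edge_pos m p < m.
Proof.
by rewrite /edge_pos size_graph_arcs; case: (directed G) => hp; case: (ltnP p (size es)) => h //; lia.
Qed.

Lemma arc_edge p : p < m -> arc p = nth a0 es p.
Proof. by move=> hp; rewrite nth_cat hp. Qed.

Lemma stored_arc p : p < size arcs -> stored G (arc p) = nth a0 es (edge_pos m p).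
Proof.
move=> hp; rewrite /edge_pos; case: ltnP => hpm.
  by rewrite arc_edge // stored_edge // -es_edges mem_nth.
move: hp; rewrite size_graph_arcs nth_cat (ltnNge p m) hpm /= /stored.
case hd: (directed G) => hp; first by lia.
have hp' : p - m < m by lia.
rewrite (nth_map a0) //.
have := mem_nth a0 hp'; rewrite es_edges => /edges_wf; rewrite hd /= => hlt.
by rewrite ltnNge ltnW //= -surjective_pairing.
Qed.

Lemma arc_reversed k : ~~ directed G -> k < m ->
  [/\ arc (m + k) = ((nth a0 es k).2, (nth a0 es k).1) & col (arc (m + k)) = color G (nth a0 es k)].
Proof.
move=> hd hk; split.
  by rewrite nth_cat ltnNge leq_addr (negbTE hd) /= addKn (nth_map a0).
rewrite /arc_color stored_arc; last by rewrite size_graph_arcs (negbTE hd) ltn_add2l.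
by rewrite /edge_pos ltnNge leq_addr addKn.
Qed.

Definition input_ok st : Prop :=
  [/\ reg st 0 = n, reg st 1 = m, reg st 2 = size ss, reg st 3 = directed G &
    [/\ forall j, j < size ss -> arr st 3 j = nth s0 ss j,
      forall i, arr st 4 i = 0 & forall v, arr st 9 v = 0]].

Definition arcs_upto k st : Prop :=
  forall i, i < k -> [/\ arr st 0 i = (arc i).1, arr st 1 i = (arc i).2
    & arr st 2 i = col (arc i)].

Lemma input_frame c st st' : same_outside c st st' -> input_ok st ->
  all (fun i => i \notin written_regs c) [:: 0; 1; 2; 3] ->
  all (fun a => a \notin written_arrs c) [:: 3; 4; 9] -> input_ok st'.
Proof.
move=> [fr fa] [h0 h1 h2 h3 [k3 k4 k9]] /and5P[r0 r1 r2 r3 _] /and4P[a_3 a_4 a_9 _].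
by split; rewrite ?fr //; split=> *; rewrite fa //; auto.
Qed.

Lemma runs_build_arcs st : input_ok st -> arcs_upto m st ->
  runs W build_arcs st (m * 30 + 30)
    (fun st' => input_ok st' /\ arcs_loaded arcs col a0 st').
Proof.
move=> hin hA; have [h0 h1 h2 h3 _] := hin.
have small' k : k < W -> k %% W = k by exact: modn_small.
have b2 b := bool_mod W_large' b.
apply: (@runs_le _ _ _ (ecost (Reg 3) + (m * 30 + 20)).+1); last by rewrite /=; lia.
apply: runs_if => /=; rewrite h3 => hd.
  apply: (@runs_le _ _ _ 2); last by lia.
  apply: (@runs_loop_free W (SetReg 4 (Reg 1)) st) => //=.
  have hd' : directed G by case: (directed G) hd.
  split; first by case: hin.
  by split=> //=; rewrite size_graph_arcs hd'.
have hd' : ~~ directed G by case: (directed G) hd.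
have hs : size arcs = m + m by rewrite size_graph_arcs (negbTE hd').
apply: runs_le.
  apply: runs_free_seq => //; apply: runs_seq.
    apply: (runs_frame (@runs_for _ _ _ (fun k st' => [/\ reg st' 1 = m, reg st' 16 = k & arcs_upto (m + k) st']) m (fun=> 23) _ _ _ _)).
    - move=> k st' hk [e1 e16 eA]; rewrite /= e1 e16 hk b2; split=> //.
      have hkA : k < m + k by lia.
      have [e_0 e_1 e_2] := eA _ hkA; have [f1 f2] := arc_reversed hd' hk.
      apply: runs_le; first apply: runs_loop_free => //; last by [].
      rewrite /= e1 e16 !(small' (m + k)); try lia.
      rewrite !(small' 1); try lia.
      rewrite (small' (k + 1)) ?addn1; last by lia.
      have nk : (k == m + k) = false by rewrite eqn_leq; lia.
      rewrite !nk e_0 e_1 e_2; split=> // i; rewrite addnS ltnS leq_eqVlt => /orP[/eqP->|hi] /=.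
        by rewrite !eqxx f2 f1 /= /arc_color stored_arc ?hs ?ltn_addr // /edge_pos hk arc_edge.
      by rewrite !(ltn_eqF hi); apply: eA.
    - by move=> st' [e1 e16 _]; rewrite /= e1 e16 ltnn b2.
    by rewrite /= mod0n; split=> //; rewrite addn0.
  move=> st1 [[e1 _ eA] fr].
  have hin1 : input_ok st1 by apply: (input_frame fr).
  apply: (@runs_loop_free W (seqs [:: SetReg 4 (Add (Reg 1) (Reg 1))]) st1) => //=.
  rewrite e1 small'; last by lia.
  split; first by case: hin1.
  split=> //=; first by case: hin1.
  by rewrite hs.
by rewrite sum_nat_const card_ord /=; lia.
Qed.

Lemma out_arcsS k (v : 'I_n) : out_arcs arcs a0 k.+1 v =
  if (arc k).1 == v then k :: out_arcs arcs a0 k v else out_arcs arcs a0 k v.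
Proof. by rewrite /out_arcs -addn1 iotaD rev_cat /= add0n. Qed.

Lemma runs_list_loop st : arcs_loaded arcs col a0 st -> reg st 12 = 0 ->
  (forall v, arr st 9 v = 0) ->
  runs W list_loop st (size arcs * 20 + 4)
    (fun st' => arcs_loaded arcs col a0 st' /\ lists_built arcs a0 st').
Proof.
move=> hA h12 h9.
have small' k : k < W -> k %% W = k by exact: modn_small.
have b2 b := bool_mod W_large' b.
apply: runs_weaken.
- apply: (@runs_for _ _ _ (fun k st' => [/\ arcs_loaded arcs col a0 st', reg st' 12 = k &
    forall v : 'I_n, chain (arr st' 10) (arr st' 9 v) (out_arcs arcs a0 k v)]) (size arcs) (fun=> 16)).
  + move=> k st' hk [eA e12 ec]; have [e0 e4 eAA] := eA; have [e_0 _ _] := eAA _ hk.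
    rewrite /= e12 e4 hk b2; split=> //.
    have := W_large' => hW.
    apply: runs_le; first apply: runs_loop_free => //; last by [].
    rewrite /= e12 e_0 !(small' 1); try lia.
    rewrite (small' (k + 1)) ?addn1; last by lia.
    split=> // v /=.
    have hchain : chain (fun j => if j == k then arr st' 9 (arc k).1 else arr st' 10 j)
        (arr st' 9 v) (out_arcs arcs a0 k v).
      apply: chain_eq (ec v) => j; rewrite mem_filter mem_rev mem_iota => /andP[_ hj].
      by case: eqP => // E; move: hj; rewrite E; lia.
    rewrite out_arcsS eq_sym (inj_eq val_inj); case: eqP => [E|_] //=.
    by split=> //; rewrite eqxx; rewrite E in hchain *.
  + by move=> st' [[_ e4 _] e12 _]; rewrite /= e4 e12 ltnn b2.
  by split=> // v; rewrite h9 /out_arcs.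
- by rewrite sum_nat_const card_ord /=; lia.
by move=> st' [].
Qed.

(** The program tries only failures of tree colors. For any other color [last_arc_off_tree] yields
    the failure-free arc, which is marked anyway. *)
Lemma marked_preserver e : e \in es ->
  (exists2 j, j < size ss & marked_source m arcs col a0 (nth s0 ss j) (index e es)) <->
  e \in preserver G es [set s in ss].
Proof.
move=> he; split.
  move=> [j hj [o _ [v hp E]]]; apply/preserverP.
  exists o, (nth s0 ss j), v, (arc (pos arcs col o (nth s0 ss j) v)); split.
  - by rewrite inE mem_nth.
  - by rewrite (last_arc_pos _ _ a0) hp.
  by rewrite stored_arc // E nth_index.
case/preserverP=> o [s [t [a [hs ha hae]]]]; rewrite inE in hs.
exists (index s ss); rewrite ?index_mem // nth_index //.
have key o' : last_arc arcs col o' s t = Some a -> marked m arcs col o' s (index e es).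
  rewrite (last_arc_pos _ _ a0); case: ifP => // hp [E]; exists t => //.
  rewrite -hae -E stored_arc // index_uniq //; exact: edge_pos_lt.
case: o ha => [c|] ha; last by exists None; [left | apply: key].
have [[v hv]|hno] := pselect (exists v, pos arcs col None s v < size arcs /\ tree_color arcs col a0 s v = c).
  by exists (Some c); [right; exists v; case: hv => // _ -> | apply: key].
exists None; first by left.
apply: key; rewrite -ha; apply/esym/last_arc_off_tree => v b.
rewrite (last_arc_pos _ _ a0); case: ifP => // hp [<-]; apply/eqP => E.
by apply: hno; exists v.
Qed.

Lemma init_input : input_ok (init_state G es ss).
Proof.
split=> //; split=> [j hj|i|v] /=; rewrite ?nth_nil //.
by rewrite (nth_map s0).
Qed.

Lemma init_arcs : arcs_upto m (init_state G es ss).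
Proof.
move=> i hi; rewrite /= !(nth_map a0) // arc_edge //; split=> //.
by rewrite /arc_color stored_edge // -es_edges mem_nth.
Qed.

Lemma output_preserver st :
  (forall e, e \in es -> arr st 4 (index e es) != 0 <-> e \in preserver G es [set s in ss]) ->
  output es st = preserver G es [set s in ss].
Proof.
move=> h; apply/setP => e; rewrite inE; apply/andP/idP => [[he]|hp].
  by move/(h e he).
have he : e \in es.
  case/preserverP: (hp) => o [s [t [a [_ /last_arcP[ha _ _ _] <-]]]].
  by rewrite es_edges -(mem_graph_arcs es_edges).
by split=> //; apply/(h e he).
Qed.

Lemma runs_main : 0 < size ss <= n ->
  runs W main_program (init_state G es ss) (6 * 1000 * (size ss * m * n).+1)
    (fun st => output es st = preserver G es [set s in ss]).
Proof.
move=> /andP[ss0 ssn]; apply: runs_le.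
  apply: runs_if => /= [_|E]; last by move: m_gt0; rewrite E.
  apply: runs_if => /= [_|E]; last by move: ss0; rewrite E.
  apply: runs_seq; first exact: runs_build_arcs init_input init_arcs.
  move=> st1 [hin1 hA1]; apply: runs_free_seq => //; apply: runs_seq.
    apply: (runs_frame (@runs_list_loop _ _ _ _)); rewrite /= ?mod0n //.
    by case: hin1 => _ _ _ _ [].
  move=> st2 [[hA2 hL2] fr].
  have [fr' fa'] := fr; have [h0 h1 h2 h3 [k3 k4 k9]] := hin1.
  apply: runs_free_seq => //; apply: runs_seq.
    apply: (@runs_source_loop W n m arcs col a0 W_large' n_gt0 m_gt0 size_arcs_le s0 ss _ ssn).
    split=> //=; rewrite ?mod0n ?fr' //.
    - by split=> //=; rewrite fr'.
    - by move=> j hj; rewrite fa' //= k3.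
    by move=> i; rewrite fa' //= k4; split=> // -[].
  move=> st3 [_ _ _ _ hout]; apply: (@runs_loop_free W Skip st3) => //=.
  by apply: output_preserver => e he; rewrite hout; exact: marked_preserver.
have hs := size_arcs_le.
rewrite /source_cost /=.
(* Preprocessing is linear in m; the product dominates it because all three factors are positive. *)
have e1 : m <= size ss * m * n by rewrite mulnAC leq_pmull // muln_gt0 ss0.
have e2 : size ss <= size ss * m * n by rewrite -mulnA leq_pmulr // muln_gt0 m_gt0.
have e3 : size ss * (5000 * (n * m) + 4) = 5000 * (size ss * m * n) + 4 * size ss.
  by rewrite mulnDr; nia.
by rewrite e3; lia.
Qed.

End MainProgram.

Lemma runs_main_preserver n (G : cgraph n) (S : {set 'I_n})
    (es : seq ('I_n * 'I_n)) (ss : seq 'I_n) (W : nat) :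
  uniq es -> es =i edges G -> uniq ss -> ss =i S ->
  (n + #|edges G| + 2) ^ 2 <= W ->
  runs W main_program (init_state G es ss) (6 * 1000 * (#|S| * #|edges G| * n).+1)
    (fun st => output es st = preserver G es S).
Proof.
move=> ues hes uss hss hW.
have hm : #|edges G| = size es by rewrite -(card_uniqP ues); apply: eq_card => e; rewrite hes.
have hS : #|S| = size ss by rewrite -(card_uniqP uss); apply: eq_card => s; rewrite hss.
have ES : S = [set s in ss] by apply/setP => s; rewrite inE hss.
rewrite hm hS {1}ES; rewrite hm in hW.
(* Without edges or sources the program halts at once; array 4 is still zero and the preserver is
   empty. *)
have stop : (size es == 0) || (size ss == 0) ->
    output es (init_state G es ss) = preserver G es [set s in ss].
  move=> h; apply: output_preserver => // e he; rewrite /= nth_nil; split=> //.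
  case/orP: h => /eqP/size0nil E; first by rewrite E in he.
  by case/preserverP=> o [s [t [a []]]]; rewrite inE E.
case: (posnP (size es)) => [m0|m0].
  apply: (@runs_le _ _ _ (ecost (Reg 1) + 1).+1); last by rewrite /=; lia.
  apply: runs_if; rewrite /= m0 // => _.
  by apply: (@runs_loop_free W Skip) => //=; apply: stop; rewrite m0.
case: (posnP (size ss)) => [s_0|s_0].
  apply: (@runs_le _ _ _ (ecost (Reg 1) + (ecost (Reg 2) + 1).+1).+1); last by rewrite /=; lia.
  apply: runs_if => [_|/= E]; last by move: m0; rewrite E.
  apply: runs_if; rewrite /= s_0 // => _.
  by apply: (@runs_loop_free W Skip) => //=; apply: stop; rewrite s_0 orbT.
have a0 : 'I_n * 'I_n by case: (es) m0 => // a.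
have s0 : 'I_n by case: (ss) s_0 => // s.
have n0 : 0 < n by case: (n) s0 => // -[].
apply: runs_main => //; last by rewrite s_0 -hS -[X in _ <= X]card_ord max_card.
(* Squaring multiplies by at least 2, enough for the up to 2m arcs of an undirected graph. *)
apply: leq_trans hW; apply: (@leq_trans (2 * (n + size es + 2))); first by lia.
by rewrite -mulnn leq_mul2r; apply/orP; right; lia.
Qed.


Local Open Scope ring_scope.

(* The edge list es, the source list ss and the word range W are arbitrary,
   subject to W being polynomially large in the input and able to hold every
   color.  The successor in the time bound only matters when |S| m n = 0. *)
Theorem theorem3p1 (R : realType) :
  exists (C : R) (p : cmd) (k T : nat),
  forall (Delta n : nat) (G : cgraph n) (S : {set 'I_n}),
    (1 <= Delta)%N ->
    (forall c : nat, (#|color_class G c| <= Delta)%N) ->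
    let good (H : {set 'I_n * 'I_n}) :=
      cft_preserver 1 G (setX S [set: 'I_n]) H /\
      (#|H|%:R <= C * size_bound R Delta n #|S|) in
    (exists H : {set 'I_n * 'I_n}, good H) /\
    (forall (es : seq ('I_n * 'I_n)) (ss : seq 'I_n) (W : nat),
       uniq es -> es =i edges G -> uniq ss -> ss =i S ->
       ((n + #|edges G| + 2) ^ k <= W)%N ->
       (forall e, e \in edges G -> (color G e < W)%N) ->
       exists (t : nat) (st : state),
         [/\ exec W p (init_state G es ss) t st,
             (t <= T * (#|S| * #|edges G| * n).+1)%N
           & good (output es st)]).
Proof.
exists (bound_const R), main_program, 2%N, (6 * 1000)%N => Delta n G S d1 hD good.
split.
  (* The bound holds for every tie-breaking order, so any enumeration of the edges serves here, and
     the input order [es] serves for the program. *)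
  exists (preserver G (enum (edges G)) S); apply: preserver_good => // e.
  by rewrite mem_enum.
move=> es ss W ues hes uss hss hW _.
have [t [st [h1 h2 h3]]] := runs_main_preserver ues hes uss hss hW.
by exists t, st; split=> //; rewrite h3; apply: preserver_good.
Qed.
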